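(* Let $(\mathcal X,d,\mu)$ be a space of homogeneous type with upper dimension $\omega$ (with $\mu(\mathcal X)$ finite or infinite), let $\{Q_k\}_{k=0}^\infty$ be an exp-IATI on $\mathcal X$ with smoothness index $\eta\in(0,1)$, let $\beta,\gamma\in(0,\eta)$, and let $s\in(0,\beta\wedge\gamma)$. (i) If $p\in[1,\infty]$ and $q\in(0,\infty]$, then $L_b(s,p,q;\mathcal X)\subset B^s_{p,q}(\mathcal X)$. (ii) If $p\in[1,\infty]$ and $q\in(\omega/[\omega+(\beta\wedge\gamma)],\infty]$, then $L_t(s,p,q;\mathcal X)\subset F^s_{p,q}(\mathcal X)$.
   Context: **Space.** A quasi-metric $d$ on a non-empty set $\mathcal X$ is a function $d:\mathcal X\times\mathcal X\to[0,\infty)$ with $d(x,y)=0\iff x=y$, $d(x,y)=d(y,x)$ and $d(x,z)\le A_0[d(x,y)+d(y,z)]$ for all $x,y,z$, for some constant $A_0\in[1,\infty)$. $B(x,r):=\{y: d(x,y)<r\}$. $(\mathcal X,d,\mu)$ is a space of homogeneous type if $\mu$ is a measure for which balls are measurable with measure in $(0,\infty)$ and there is $C_{(\mu)}\in[1,\infty)$ with $\mu(B(x,2r))\le C_{(\mu)}\mu(B(x,r))$ for all $x,r$; $\omega:=\log_2C_{(\mu)}$ is the upper dimension. Notation: $V_r(x):=\mu(B(x,r))$, $V(x,y):=\mu(B(x,d(x,y)))$ (so $V(x,x)=0$), $a\wedge b:=\min\{a,b\}$, $\mathbb N=\{1,2,\dots\}$, $m_E(f):=\frac1{\mu(E)}\int_Ef\,d\mu$.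 **Dyadic system.** Fix $0<c_0\le C_0<\infty$ and $\delta$ with $0<\delta\le(2A_0)^{-10}$, $12A_0^3C_0\delta\le c_0$, and points $\{z^k_\alpha:k\in\mathbb Z,\alpha\in\mathcal A_k\}\subset\mathcal X$ such that, for each $k$, $d(z^k_\alpha,z^k_\beta)\ge c_0\delta^k$ if $\alpha\ne\beta$, and $\min_{\alpha\in\mathcal A_k}d(x,z_\alpha^k)<C_0\delta^k$ for all $x$. Fix an associated system of dyadic cubes $\{Q^k_\alpha\}$: for each $k$ the sets $Q_\alpha^k$ ($\alpha\in\mathcal A_k$) are disjoint with union $\mathcal X$; if $k\le l$ then either $Q^l_\beta\subset Q^k_\alpha$ or $Q^l_\beta\cap Q^k_\alpha=\emptyset$; and $B(z^k_\alpha,(3A_0^2)^{-1}c_0\delta^k)\subset Q^k_\alpha\subset B(z^k_\alpha,2A_0C_0\delta^k)$. Put $\mathcal G_k:=\mathcal A_{k+1}\setminus\mathcal A_k$, $\mathcal Y^k:=\{z_\alpha^{k+1}\}_{\alpha\in\mathcal G_k}$, $d(x,\mathcal Y^k):=\inf_{y\in\mathcal Y^k}d(x,y)$. Fix $j_0\in\mathbb N$ sufficiently large that $\delta^{j_0}\le(2A_0)^{-3}C_0$; for $k\in\mathbb Z$, $\alpha\in\mathcal A_k$, the cubes $Q_\tau^{k+j_0}$ ($\tau\in\mathcal A_{k+j_0}$) contained in $Q_\alpha^k$ are enumerated as $Q_\alpha^{k,m}$, $m=1,\dots,N(k,\alpha)$. **exp-IATI.** For $k\ge0$ let $$e_k(x,y):=\frac{1}{\sqrt{V_{\delta^k}(x)V_{\delta^k}(y)}}\exp\Big\{-\nu\Big[\frac{d(x,y)}{\delta^k}\Big]^a\Big\},\quad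 h_k(x,y):=\exp\Big\{-\nu\Big[\frac{\max\{d(x,\mathcal Y^k),d(y,\mathcal Y^k)\}}{\delta^k}\Big]^a\Big\}.$$ A sequence $\{Q_k\}_{k=0}^\infty$ of bounded linear integral operators on $L^2(\mathcal X)$ (kernels also denoted $Q_k(x,y)$) is an exp-IATI (inhomogeneous approximation of the identity with exponential decay) with smoothness index $\eta\in(0,1)$ if $\sum_{k=0}^\infty Q_k=I$ in $L^2(\mathcal X)$ and there are $C,\nu\in(0,\infty)$, $a\in(0,1]$ such that, with $E_k:=e_kh_k$ for $k\ge1$ and $E_0:=e_0$, for all $k\ge0$: $|Q_k(x,y)|\le CE_k(x,y)$ for all $x,y$; if $d(x,x')\le\delta^k$, then $|Q_k(x,y)-Q_k(x',y)|+|Q_k(y,x)-Q_k(y,x')|\le C[d(x,x')/\delta^k]^\eta E_k(x,y)$; if $d(x,x')\le\delta^k$ and $d(y,y')\le\delta^k$, then $|[Q_k(x,y)-Q_k(x',y)]-[Q_k(x,y')-Q_k(x',y')]|\le C[d(x,x')/\delta^k]^\eta[d(y,y')/\delta^k]^\eta E_k(x,y)$; and for all $x$, $\int Q_k(x,y)\,d\mu(y)=\int Q_k(y,x)\,d\mu(y)$ equals $0$ if $k\ge1$ and $1$ if $k=0$. **Test functions and distributions.** For $x_1\in\mathcal X$, $r\in(0,\infty)$, $\beta\in(0,1]$, $\gamma\in(0,\infty)$, $\mathcal G(x_1,r,\beta,\gamma)$ is the set of measurable $f$ for which there is $C$ with (a) $|f(x)|\le C\frac1{V_r(x_1)+V(x_1,x)}[\frac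 r{r+d(x_1,x)}]^\gamma$ for all $x$; (b) $|f(x)-f(y)|\le C[\frac{d(x,y)}{r+d(x_1,x)}]^\beta\frac1{V_r(x_1)+V(x_1,x)}[\frac r{r+d(x_1,x)}]^\gamma$ whenever $d(x,y)\le(2A_0)^{-1}[r+d(x_1,x)]$; its norm is the infimum of such $C$. Fix $x_0\in\mathcal X$, $r_0\in(0,\infty)$ and set $\mathcal G(\beta,\gamma):=\mathcal G(x_0,r_0,\beta,\gamma)$ (independent of the choice up to equivalent norms). For $\beta,\gamma\in(0,\eta]$, $\mathcal G_0^\eta(\beta,\gamma)$ is the completion of $\mathcal G(\eta,\eta)$ in $\mathcal G(\beta,\gamma)$, and $(\mathcal G_0^\eta(\beta,\gamma))'$ is its dual with the weak-$*$ topology. For $f$ in this dual, $Q_kf(x)=Q_k(f)(x):=\langle f,Q_k(x,\cdot)\rangle$. **The number $N$.** $N\in\mathbb N$ is a fixed number for which the following discrete Calderón reproducing formula (known to hold) is valid: for any choice of points $y_\alpha^{k,m}\in Q_\alpha^{k,m}$ there are bounded integral operators $\widetilde Q_k$ ($k\ge0$) on $L^2(\mathcal X)$ such that, for all $f\in(\mathcal G_0^\eta(\beta,\gamma))'$, in $(\mathcal G_0^\eta(\beta,\gamma))'$, $$f=\sum_{\alpha\in\mathcal A_0}\sum_{m=1}^{N(0,\alpha)}\int_{Q_\alpha^{0,m}}\widetilde Q_0(\cdot,y)\,d\mu(y)\,m_{Q_\alpha^{0,m}}(Q_0f)+\sum_{k=1}^N\sum_{\alpha\in\mathcal A_k}\sum_{m=1}^{N(k,\alpha)}\mu(Q_\alpha^{k,m})\widetilde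 Q_k(\cdot,y_\alpha^{k,m})\,m_{Q_\alpha^{k,m}}(Q_kf)+\sum_{k=N+1}^\infty\sum_{\alpha\in\mathcal A_k}\sum_{m=1}^{N(k,\alpha)}\mu(Q_\alpha^{k,m})\widetilde Q_k(\cdot,y_\alpha^{k,m})Q_kf(y_\alpha^{k,m}),$$ where, with $R_\gamma(x,y;k):=\frac1{V_{\delta^k}(x)+V(x,y)}[\frac{\delta^k}{\delta^k+d(x,y)}]^\gamma$ and $C$ independent of $k$ and of the points, $|\widetilde Q_k(x,y)|\le CR_\gamma(x,y;k)$, $|\widetilde Q_k(x,y)-\widetilde Q_k(x',y)|\le C[\frac{d(x,x')}{\delta^k+d(x,y)}]^\beta R_\gamma(x,y;k)$ if $d(x,x')\le(2A_0)^{-1}[\delta^k+d(x,y)]$, and $\int\widetilde Q_k(x,y)\,d\mu(y)=\int\widetilde Q_k(y,x)\,d\mu(y)$ equals $1$ for $k\le N$ and $0$ for $k>N$. **Besov and Triebel–Lizorkin spaces** (independent of the choice of $\beta,\gamma$ and the exp-IATI). With $\eta,\beta,\gamma,s$ as in the claim, for $p\in(\omega/[\omega+(\beta\wedge\gamma)],\infty]$, $q\in(0,\infty]$, $B^s_{p,q}(\mathcal X)$ is the set of $f\in(\mathcal G_0^\eta(\beta,\gamma))'$ with finite $$\|f\|_{B^s_{p,q}(\mathcal X)}:=\Big\{\sum_{k=0}^N\sum_{\alpha\in\mathcal A_k}\sum_{m=1}^{N(k,\alpha)}\mu(Q_\alpha^{k,m})[m_{Q_\alpha^{k,m}}(|Q_kf|)]^p\Big\}^{1/p}+\Big[\sum_{k=N+1}^\infty\delta^{-ksq}\|Q_kf\|_{L^p(\mathcal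 X)}^q\Big]^{1/q};$$ for $p\in(\omega/[\omega+(\beta\wedge\gamma)],\infty)$, $q\in(\omega/[\omega+(\beta\wedge\gamma)],\infty]$, $F^s_{p,q}(\mathcal X)$ is defined in the same way with the last term replaced by $\big\|\big[\sum_{k=N+1}^\infty\delta^{-ksq}|Q_kf|^q\big]^{1/q}\big\|_{L^p(\mathcal X)}$; and $F^s_{\infty,q}(\mathcal X)$ is the set of $f\in(\mathcal G_0^\eta(\beta,\gamma))'$ with finite $$\|f\|_{F^s_{\infty,q}(\mathcal X)}:=\max\Big[\sup_{0\le k\le N}\sup_{\alpha\in\mathcal A_k}\sup_{1\le m\le N(k,\alpha)}m_{Q_\alpha^{k,m}}(|Q_kf|),\ \sup_{l\in\mathbb N,\,l>N}\sup_{\alpha\in\mathcal A_l}\Big\{\frac1{\mu(Q_\alpha^l)}\int_{Q_\alpha^l}\sum_{k=l}^\infty\delta^{-ksq}|Q_kf(x)|^q\,d\mu(x)\Big\}^{1/q}\Big].$$ Usual modifications: for $B^s_{\infty,q}$ the first term is the supremum of $m_{Q_\alpha^{k,m}}(|Q_kf|)$ over $k\le N,\alpha,m$; when $q=\infty$ sums over $k$ are replaced by suprema of $\delta^{-ks}(\cdots)$, and the last brace in $F^s_{\infty,\infty}$ by the essential supremum over $x\in Q_\alpha^l$ of $\sup_{k\ge l}\delta^{-ks}|Q_kf(x)|$. **Lipschitz-type spaces.** Fix a constant $\widetilde C\in(0,\infty)$ and write $B_k(x):=B(x,\widetilde C\delta^k)$. For $s\in(0,\infty)$, $p,q\in(0,\infty]$: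 - $L_b(s,p,q;\mathcal X)$: all $f\in L^p(\mathcal X)$ with finite $\|f\|:=\|f\|_{L^p(\mathcal X)}+\big(\sum_{k\in\mathbb Z}\delta^{-ksq}\big\{\int_{\mathcal X}\big[\frac1{\mu(B_k(x))}\int_{B_k(x)}|f(x)-f(y)|\,d\mu(y)\big]^p\,d\mu(x)\big\}^{q/p}\big)^{1/q}$; - $L_t(s,p,q;\mathcal X)$: all $f\in L^p(\mathcal X)$ with finite $\|f\|:=\|f\|_{L^p(\mathcal X)}+\big\|\big\{\sum_{k=0}^\infty\delta^{-ksq}\big[\frac1{\mu(B_k(\cdot))}\int_{B_k(\cdot)}|f(\cdot)-f(y)|\,d\mu(y)\big]^q\big\}^{1/q}\big\|_{L^p(\mathcal X)}$. Usual modifications (essential supremum in $x$ when $p=\infty$; supremum over $k$ when $q=\infty$). **Identification.** A function $f$ is identified with the distribution $g\mapsto\int_{\mathcal X}fg\,d\mu$, $g\in\mathcal G_0^\eta(\beta,\gamma)$. *)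

(* Defs.v *)
From HB Require Import structures.
From mathcomp Require Import all_boot all_order all_algebra.
From mathcomp Require Import all_classical all_reals all_analysis.
From mathcomp Require Import ess_sup_inf.
Import Order.TTheory GRing.Theory Num.Theory.
Import numFieldNormedType.Exports.

Set Implicit Arguments.
Unset Strict Implicit.
Unset Printing Implicit Defensive.

Local Open Scope classical_set_scope.
Local Open Scope ring_scope.

Section quasi_metric.
Context {R : realType} {disp : measure_display} {X : measurableType disp}.
Implicit Types (d : X -> X -> R) (mu : {measure set X -> \bar R}).

Definition quasi_metric d (A0 : R) : Prop :=
  [/\ 1 <= A0,
      forall x y, 0 <= d x y,
      forall x y, d x y = 0 <-> x = y,
      forall x y, d x y = d y x
    & forall x y z, d x z <= A0 * (d x y + d y z)].

Definition qball d (x : X) (r : R) : set X := [set y | d x y < r].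

(* The sigma-algebra is only required to contain the balls. *)
Definition homogeneous_type d mu (Cmu : R) : Prop :=
  [/\ 1 <= Cmu,
      forall x r, 0 < r -> measurable (qball d x r),
      forall x r, 0 < r -> (0 < mu (qball d x r) < +oo)%E
    & forall x r, 0 < r ->
        (mu (qball d x (2 * r)) <= Cmu%:E * mu (qball d x r))%E].

Definition upper_dim (Cmu : R) : R := ln Cmu / ln 2.

Definition Vr d mu (r : R) (x : X) : R := fine (mu (qball d x r)).

Definition Vxy d mu (x y : X) : R := fine (mu (qball d x (d x y))).

Definition mean mu (E : set X) (f : X -> R) : R :=
  (fine (mu E))^-1 * \int[mu]_(x in E) f x.

Definition emean mu (E : set X) (f : X -> \bar R) : \bar R :=
  (((fine (mu E))^-1)%:E * \int[mu]_(x in E) f x)%E.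

(* The integral defining K f is required to converge only for a.e. x. *)
Definition L2_integral_operator mu (K : X -> X -> R) : Prop :=
  measurable_fun setT (fun u : X * X => K u.1 u.2) /\
  exists2 C : R, 0 <= C & forall f : X -> R, f \in Lfun mu 2%:E ->
    {ae mu, forall x, mu.-integrable setT (fun y => (K x y * f y)%:E)} /\
    ('N[mu]_(2%:E) [(fun x => (\int[mu]_y (K x y * f y))%:E)]
       <= C%:E * 'N[mu]_(2%:E) [EFin \o f])%E.

End quasi_metric.

(* The cubes are required to be measurable, which is implicit in mu(Q). *)
Record dyadic_system {R : realType} {disp : measure_display}
    {X : measurableType disp} (I : choiceType) (d : X -> X -> R) (A0 : R) :=
  DyadicSystem {
  dy_c0 : R;
  dy_C0 : R;
  dy_delta : R;
  dy_idx : int -> set I;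
  dy_pt : int -> I -> X;
  dy_cube : int -> I -> set X;
  dy_j0 : nat;
  dy_num : int -> I -> nat;
  dy_enum : int -> I -> nat -> I;
  dy_c0C0 : 0 < dy_c0 <= dy_C0;
  dy_delta_range : 0 < dy_delta <= (2 * A0) ^- 10;
  dy_delta_small : 12 * A0 ^+ 3 * dy_C0 * dy_delta <= dy_c0;
  dy_separated : forall k a b, dy_idx k a -> dy_idx k b -> a <> b ->
    dy_c0 * dy_delta ^ k <= d (dy_pt k a) (dy_pt k b);
  dy_dense : forall k x,
    exists2 a, dy_idx k a & d x (dy_pt k a) < dy_C0 * dy_delta ^ k;
  dy_measurable : forall k a, dy_idx k a -> measurable (dy_cube k a);
  dy_disjoint : forall k, trivIset (dy_idx k) (dy_cube k);
  dy_cover : forall k, \bigcup_(a in dy_idx k) dy_cube k a = setT;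
  dy_nested : forall k l a b, k <= l -> dy_idx k a -> dy_idx l b ->
    dy_cube l b `<=` dy_cube k a \/ dy_cube l b `&` dy_cube k a = set0;
  dy_inner : forall k a, dy_idx k a ->
    qball d (dy_pt k a) ((3 * A0 ^+ 2)^-1 * dy_c0 * dy_delta ^ k)
      `<=` dy_cube k a;
  dy_outer : forall k a, dy_idx k a ->
    dy_cube k a
      `<=` qball d (dy_pt k a) (2 * A0 * dy_C0 * dy_delta ^ k);
  dy_j0_gt0 : (0 < dy_j0)%N;
  dy_j0_large : dy_delta ^+ dy_j0 <= (2 * A0) ^- 3 * dy_C0;
  dy_enumP : forall k a, dy_idx k a ->
    set_bij [set m | (0 < m <= dy_num k a)%N]
      [set t | dy_idx (k + dy_j0%:Z) t /\
               dy_cube (k + dy_j0%:Z) t `<=` dy_cube k a]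
      (dy_enum k a)
}.

(* Unconditional summation of a real family over D. *)
Definition has_sum {R : realType} {I : choiceType} (D : set I) (u : I -> R)
    (S : R) : Prop :=
  forall e : R, 0 < e ->
  exists2 F0 : set I, finite_set F0 /\ F0 `<=` D &
  forall F : set I, finite_set F -> F0 `<=` F -> F `<=` D ->
    `| \sum_(i \in F) u i - S | < e.

(* The l^q quasi-norm over K of a family of nonnegative extended reals, for
   0 < q <= +oo. *)
Definition lq {R : realType} {I : choiceType} (K : set I) (q : \bar R)
    (u : I -> \bar R) : \bar R :=
  match q with
  | q%:E => ((\esum_(k in K) (u k `^ q)) `^ q^-1)%E
  | +oo%E => ereal_sup (u @` K)
  | -oo%E => 0%E
  end.

Section spaces.
Context {R : realType} {disp : measure_display} {X : measurableType disp}.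
Context {I : choiceType}.
Variables (d : X -> X -> R) (mu : {measure set X -> \bar R}) (A0 : R).
Variable D : dyadic_system I d A0.

Local Notation delta := (dy_delta D).

(* The m-th subcube Q_a^{k,m} of Q_a^k, 1 <= m <= dy_num D k a. *)
Definition subcube (k : nat) (a : I) (m : nat) : set X :=
  dy_cube D (k%:Z + (dy_j0 D)%:Z) (dy_enum D k%:Z a m).

Definition subcube_index (k : nat) (a : I) (m : nat) : Prop :=
  dy_idx D k%:Z a /\ (0 < m <= dy_num D k%:Z a)%N.

Definition Y (k : nat) : set X :=
  dy_pt D (k%:Z + 1) @` (dy_idx D (k%:Z + 1) `\` dy_idx D k%:Z).

(* Equal to +oo when Y k is empty; then [hk] below vanishes for the parameters
   nu > 0 and a > 0 it is used with. *)
Definition dist_Y (k : nat) (x : X) : \bar R :=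
  ereal_inf [set (d x y)%:E | y in Y k].

Definition ek (nu a : R) (k : nat) (x y : X) : R :=
  (Num.sqrt (Vr d mu (delta ^+ k) x * Vr d mu (delta ^+ k) y))^-1
  * expR (- (nu * (d x y / delta ^+ k) `^ a)).

Definition hk (nu a : R) (k : nat) (x y : X) : R :=
  fine (expeR (- (nu%:E *
    (maxe (dist_Y k x) (dist_Y k y) * ((delta ^+ k)^-1)%:E) `^ a))%E).

Definition Ek (nu a : R) (k : nat) (x y : X) : R :=
  if k is 0%N then ek nu a 0 x y else ek nu a k x y * hk nu a k x y.

Definition exp_IATI (eta : R) (Q : nat -> X -> X -> R) : Prop :=
  (forall k, L2_integral_operator mu (Q k)) /\
  (forall f : X -> R, f \in Lfun mu 2%:E ->
     (fun n => 'N[mu]_(2%:E) [(fun x =>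
        (\sum_(0 <= k < n) \int[mu]_y (Q k x y * f y) - f x)%:E)]%E)
     @ \oo --> 0%E) /\
  exists C nu a : R, [/\ 0 < C, 0 < nu, 0 < a <= 1 &
    forall k : nat, [/\
      forall x y, `|Q k x y| <= C * Ek nu a k x y,
      forall x x' y, d x x' <= delta ^+ k ->
        `|Q k x y - Q k x' y| + `|Q k y x - Q k y x'|
          <= C * (d x x' / delta ^+ k) `^ eta * Ek nu a k x y,
      forall x x' y y', d x x' <= delta ^+ k -> d y y' <= delta ^+ k ->
        `|(Q k x y - Q k x' y) - (Q k x y' - Q k x' y')|
          <= C * (d x x' / delta ^+ k) `^ eta * (d y y' / delta ^+ k) `^ eta
             * Ek nu a k x y,
      forall x, \int[mu]_y Q k x y = (k == 0%N)%:R
    & forall x, \int[mu]_y Q k y x = (k == 0%N)%:R]].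

Definition test_bound (x1 : X) (r beta gamma : R) (f : X -> R) (C : R) : Prop :=
  (forall x, `|f x| <= C * (Vr d mu r x1 + Vxy d mu x1 x)^-1
                         * (r / (r + d x1 x)) `^ gamma) /\
  (forall x y, d x y <= (2 * A0)^-1 * (r + d x1 x) ->
     `|f x - f y| <= C * (d x y / (r + d x1 x)) `^ beta
                       * (Vr d mu r x1 + Vxy d mu x1 x)^-1
                       * (r / (r + d x1 x)) `^ gamma).

Definition test_fun (x1 : X) (r beta gamma : R) : set (X -> R) :=
  [set f | measurable_fun setT f /\
           exists C, test_bound x1 r beta gamma f C].

Definition test_norm (x1 : X) (r beta gamma : R) (f : X -> R) : R :=
  inf [set C | test_bound x1 r beta gamma f C].

Section distributions.
Variables (x0 : X) (r0 eta beta gamma : R).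

(* The closure of G(eta, eta) in G(beta, gamma), with the norm of
   G(beta, gamma). *)
Definition test_space : set (X -> R) :=
  [set f | test_fun x0 r0 beta gamma f /\
    forall e : R, 0 < e -> exists2 g, test_fun x0 r0 eta eta g &
      test_fun x0 r0 beta gamma (f \- g) /\
      test_norm x0 r0 beta gamma (f \- g) < e].

(* Bounded linear functionals on [test_space]; their values at functions outside
   [test_space] are irrelevant. *)
Definition distribution : set ((X -> R) -> R) :=
  [set T | (forall (c : R) g h, test_space g -> test_space h ->
              T (fun x => c * g x + h x) = c * T g + T h) /\
           exists C : R, forall g, test_space g ->
              `|T g| <= C * test_norm x0 r0 beta gamma g].

Definition distr_of_fun (f : X -> R) : (X -> R) -> R :=
  fun g => \int[mu]_x (f x * g x).

Variable Q : nat -> X -> X -> R.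

Definition Qapp (k : nat) (T : (X -> R) -> R) (x : X) : R := T (Q k x).

Definition Rgamma (x y : X) (k : nat) : R :=
  (Vr d mu (delta ^+ k) x + Vxy d mu x y)^-1
  * (delta ^+ k / (delta ^+ k + d x y)) `^ gamma.

Definition calderon_kernel (N : nat) (C : R) (Qt : nat -> X -> X -> R) : Prop :=
  forall k : nat, [/\
    L2_integral_operator mu (Qt k),
    forall x y, `|Qt k x y| <= C * Rgamma x y k,
    forall x x' y, d x x' <= (2 * A0)^-1 * (delta ^+ k + d x y) ->
      `|Qt k x y - Qt k x' y|
        <= C * (d x x' / (delta ^+ k + d x y)) `^ beta * Rgamma x y k,
    forall x, \int[mu]_y Qt k x y = (k <= N)%N%:R
  & forall x, \int[mu]_y Qt k y x = (k <= N)%N%:R].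

(* The (k, a, m) term of the reproducing formula for T, tested against g; the
   points y k a m are the sample points. *)
Definition calderon_term (N : nat) (Qt : nat -> X -> X -> R)
    (y : nat -> I -> nat -> X) (T : (X -> R) -> R) (g : X -> R)
    (k : nat) (a : I) (m : nat) : R :=
  (if k is 0%N then
     \int[mu]_x ((\int[mu]_(z in subcube 0 a m) Qt 0%N x z) * g x)
   else fine (mu (subcube k a m)) * \int[mu]_x (Qt k x (y k a m) * g x))
  * (if (k <= N)%N then mean mu (subcube k a m) (Qapp k T)
     else Qapp k T (y k a m)).

(* The sum over a is unconditional, the sum over k is the limit of its partial
   sums; convergence is weak-*. *)
Definition calderon_number (N : nat) : Prop :=
  (0 < N)%N /\
  exists C : R, 0 < C /\
  forall y : nat -> I -> nat -> X,
    (forall k a m, subcube_index k a m -> subcube k a m (y k a m)) ->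
  exists Qt : nat -> X -> X -> R, calderon_kernel N C Qt /\
  forall T, distribution T -> forall g, test_space g ->
  exists S : nat -> R,
    (forall k : nat, has_sum (dy_idx D k%:Z)
       (fun a => \sum_(1 <= m < (dy_num D k%:Z a).+1)
          calderon_term N Qt y T g k a m) (S k)) /\
    series S @ \oo --> T g.

Section BesovTriebel.
Variables (N : nat) (s : R) (p q : \bar R) (T : (X -> R) -> R).

Definition absmean (k : nat) (a : I) (m : nat) : \bar R :=
  emean mu (subcube k a m) (fun x => `|Qapp k T x|%:E).

Definition sup_absmean : \bar R :=
  ereal_sup [set v | exists k a m,
    [/\ (k <= N)%N, subcube_index k a m & v = absmean k a m]].

Definition low_freq : \bar R :=
  match p with
  | p%:E => ((\sum_(0 <= k < N.+1) \esum_(a in dy_idx D k%:Z)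
       \sum_(1 <= m < (dy_num D k%:Z a).+1)
         (mu (subcube k a m) * absmean k a m `^ p)) `^ p^-1)%E
  | +oo%E => sup_absmean
  | -oo%E => 0%E
  end.

Definition besov_norm : \bar R :=
  (low_freq +
   lq [set k | (N < k)%N] q (fun k =>
     (delta `^ (- (k%:R * s)))%:E *
       'N[mu]_p [(fun x => (Qapp k T x)%:E)]))%E.

Definition triebel_norm_fin : \bar R :=
  (low_freq +
   'N[mu]_p [(fun x => lq [set k | (N < k)%N] q (fun k =>
     (delta `^ (- (k%:R * s)) * `|Qapp k T x|)%:E))])%E.

Definition triebel_tail (l : nat) (a : I) : \bar R :=
  match q with
  | q%:E => (emean mu (dy_cube D l%:Z a) (fun x =>
      \esum_(k in [set k | (l <= k)%N])
        (delta `^ (- (k%:R * s * q)) * `|Qapp k T x| `^ q)%:E) `^ q^-1)%E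
  | +oo%E => ess_sup mu ((fun x =>
      ereal_sup [set (delta `^ (- (k%:R * s)) * `|Qapp k T x|)%:E
                | k in [set k | (l <= k)%N]]) \_ (dy_cube D l%:Z a))
  | -oo%E => 0%E
  end.

Definition triebel_norm_infty : \bar R :=
  maxe sup_absmean
    (ereal_sup [set v | exists l a,
       [/\ (N < l)%N, dy_idx D l%:Z a & v = triebel_tail l a]]).

Definition triebel_norm : \bar R :=
  if p is +oo%E then triebel_norm_infty else triebel_norm_fin.

End BesovTriebel.

Definition besov (N : nat) (s : R) (p q : \bar R) : set ((X -> R) -> R) :=
  [set T | distribution T /\ (besov_norm N s p q T < +oo)%E].

Definition triebel_lizorkin (N : nat) (s : R) (p q : \bar R) :
    set ((X -> R) -> R) :=
  [set T | distribution T /\ (triebel_norm N s p q T < +oo)%E].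

End distributions.

Section Lipschitz.
Variable Ct : R.

Definition osc (k : int) (f : X -> R) (x : X) : \bar R :=
  emean mu (qball d x (Ct * delta ^ k)) (fun y => `|f x - f y|%:E).

Definition lip_b (s : R) (p q : \bar R) : set (X -> R) :=
  [set f | f \in Lfun mu p /\
    ('N[mu]_p [EFin \o f] +
     lq setT q (fun k : int =>
       (delta `^ (- (k%:~R * s)))%:E * 'N[mu]_p [osc k f]) < +oo)%E].

Definition lip_t (s : R) (p q : \bar R) : set (X -> R) :=
  [set f | f \in Lfun mu p /\
    ('N[mu]_p [EFin \o f] +
     'N[mu]_p [(fun x => lq [set: nat] q (fun k =>
       (delta `^ (- (k%:R * s)))%:E * osc k%:Z f x))] < +oo)%E].

End Lipschitz.

End spaces.

(* Main.v *)
(** By cancellation [Q_k f(x)] is the integral of [Q_k(x,y) (f(y) - f(x))] (plus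
    [f(x)] if [k = 0]), and the exponential decay of [Q_k] beats the polynomial
    growth of the measures of balls. Hence, for every [rho] in (0,1),
    [|Q_k f(x)| <= C sum_(i >= 0) rho^i U_(k-i)(x)], where [U_j(x)] is a mean
    oscillation of [f] around [x] at scale [delta^j]. With [rho = delta^s / 2],
    the sequence [delta^(-ks) |Q_k f(x)|] is dominated by the convolution of
    [delta^(-js) U_j(x)], [j] in Z, with a geometric sequence; for [j >= 0] the
    latter is controlled by the Lipschitz norm and, since [s > 0], for [j < 0]
    simply by [||U_j||_p <= C ||f||_p].

    As [d] need not be jointly measurable, the means over [B(x, r)] need not be
    measurable functions of [x]. So [U_j] uses a ball centred at the centre of a
    small dyadic cube containing [x]: it depends measurably on [x], is contained
    in [B(x, Ct delta^j)] and has comparable measure. *)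

From HB Require Import structures.
Require Import Defs.
From mathcomp Require Import all_boot all_order all_algebra.
From mathcomp Require Import finmap.
From mathcomp Require Import all_classical all_reals all_analysis.
From mathcomp Require Import ess_sup_inf measurable_realfun.
From mathcomp Require Import ring lra.
Import Order.TTheory GRing.Theory Num.Theory.
Import numFieldNormedType.Exports.

Set Implicit Arguments.
Unset Strict Implicit.
Unset Printing Implicit Defensive.

Local Open Scope classical_set_scope.
Local Open Scope ring_scope.

(** * Geometric sums and discrete norms *)

(** The two parts take the norms in opposite orders. In (i) the [L^p] norm comes first and the
    convolution acts on the norms of [delta^(-js) U_j]; the [L_b] norm already runs over all
    integers [j]. In (ii) the convolution acts at each point, before the [L^p] norm, and the [L_t]
    norm contains the scales [j >= 0] only, so the negative scales have to be split off. As [q < 1]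
    is allowed, the triangle inequality in [l^q] is not at hand. Every infinite sum therefore
    carries geometric weights: a power of such a sum is at most a constant times a weighted sum of
    the powers, with another ratio. The condition [p >= 1] enters through Jensen's inequality for
    averages and in showing that [f] defines a distribution. Norms of functions not known to be
    measurable, such as [osc], are compared with norms of measurable ones by monotonicity alone;
    constants are always pulled out on the measurable side. *)

Section extended_powers.
Context {R : realType}.
Local Open Scope ereal_scope.

Lemma le_poweR (x y : \bar R) (r : R) : (0 <= r)%R -> 0 <= x -> x <= y ->
  x `^ r <= y `^ r.
Proof.
move=> r0 x0 xy; apply: gt0_ler_poweR => //; rewrite in_itv /= leey andbT //.
exact: le_trans xy.
Qed.

Lemma poweRK (x : \bar R) (r : R) : (0 < r)%R -> 0 <= x -> (x `^ r) `^ r^-1 = x.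
Proof. by move=> r0 x0; rewrite -poweRrM divff ?gt_eqF// poweRe1. Qed.

Lemma poweRVK (x : \bar R) (r : R) : (0 < r)%R -> 0 <= x -> (x `^ r^-1) `^ r = x.
Proof. by move=> r0 x0; rewrite -poweRrM mulVf ?gt_eqF// poweRe1. Qed.

Lemma nneseries_geometric (t : R) : (0 < t < 1)%R ->
  \sum_(i <oo) (t ^+ i)%:E = ((1 - t)^-1)%:E.
Proof.
move=> /andP[t0 t1]; apply/cvg_lim => //.
have -> : (fun n => \sum_(0 <= i < n) (t ^+ i)%:E) = EFin \o series (geometric 1 t).
  apply/funext => n /=; rewrite sumEFin; congr EFin; apply: eq_bigr => i _.
  by rewrite /= mul1r.
apply: cvg_EFin; first exact: nearW.
rewrite -[X in _ --> X](mul1r) /=.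
have -> : fine \o (EFin \o series (geometric 1 t)) = series (geometric 1 t) by [].
by apply: cvg_geometric_series; rewrite ger0_norm// ltW.
Qed.

Lemma EFin_exp_ge0 (t : R) (i : nat) : (0 <= t)%R -> 0 <= (t ^+ i)%:E.
Proof. by move=> t0; rewrite lee_fin exprn_ge0. Qed.

Lemma nneseries_ge_term (u : nat -> \bar R) (i : nat) : (forall i, 0 <= u i) ->
  u i <= \sum_(i <oo) u i.
Proof.
move=> u0; rewrite (@nneseriesD1 _ _ i xpredT)// leeDl//.
exact: nneseries_ge0.
Qed.

Lemma nneseries_geometric_le (t : R) (M : \bar R) (u : nat -> \bar R) :
  (0 < t < 1)%R -> (forall i, 0 <= u i <= M) ->
  \sum_(i <oo) (t ^+ i)%:E * u i <= ((1 - t)^-1)%:E * M.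
Proof.
move=> t01 uM; have [t0 t1] := andP t01.
have t'0 : (0 < (1 - t)^-1)%R by rewrite invr_gt0 subr_gt0.
have [->|My] := eqVneq M +oo; first by rewrite gt0_muley ?leey.
have Mf : M \is a fin_num.
  by rewrite ge0_fin_numE ?ltey//; have /andP[] := uM 0%N; exact: le_trans.
rewrite -nneseries_geometric// muleC -(fineK Mf) -nneseriesZl//; last first.
  by move=> i _; rewrite EFin_exp_ge0// ltW.
apply: lee_nneseries => i _; have /andP[u0 ule] := uM i.
  by rewrite mule_ge0// EFin_exp_ge0// ltW.
by rewrite fineK// [leRHS]muleC lee_wpmul2l// EFin_exp_ge0// ltW.
Qed.

Lemma exprn_powR (a r : R) (i : nat) : (0 <= a)%R ->
  ((a ^+ i) `^ r = (a `^ r) ^+ i)%R.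
Proof.
by move=> a0; rewrite -(powR_mulrn i a0) -(powR_mulrn i (powR_ge0 a r)) powRAC.
Qed.

(* With [q^2 = t], the sum is at most [(1 - q)^-1] times any common bound of the
   [q^i u_i]; no convexity is involved, so [r < 1] is allowed. *)
Lemma geometric_poweR (t r : R) : (0 < t < 1)%R -> (0 < r)%R ->
  exists C k : R, [/\ (0 < C)%R, (0 < k < 1)%R &
    forall u : nat -> \bar R, (forall i, 0 <= u i) ->
    (\sum_(i <oo) (t ^+ i)%:E * u i) `^ r <=
      C%:E * \sum_(i <oo) (k ^+ i)%:E * u i `^ r].
Proof.
move=> /andP[t0 t1] r0; pose q := Num.sqrt t.
have q0 : (0 < q)%R by rewrite sqrtr_gt0.
have q1 : (q < 1)%R by rewrite -sqrtr1 ltr_sqrt.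
have qq : (q * q = t)%R by rewrite -expr2 sqr_sqrtr// ltW.
exists ((1 - q)^-1 `^ r)%R, (q `^ r)%R; split.
- by rewrite powR_gt0// invr_gt0 subr_gt0.
- rewrite powR_gt0//=.
  have : (q `^ r < 1 `^ r)%R by rewrite gt0_ltr_powR// nnegrE ltW.
  by rewrite powR1.
move=> u u0; set Z := (X in _ <= _ * X).
have Z0 : 0 <= Z.
  by apply: nneseries_ge0 => i _ _; rewrite mule_ge0 ?poweR_ge0// EFin_exp_ge0// powR_ge0.
have qu i : (q ^+ i)%:E * u i <= Z `^ r^-1.
  have h0 : 0 <= (q ^+ i)%:E * u i by rewrite mule_ge0// EFin_exp_ge0// ltW.
  rewrite -(poweRK r0 h0); apply: le_poweR; rewrite ?invr_ge0 ?(ltW r0) ?poweR_ge0//.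
  rewrite poweRM ?u0 ?EFin_exp_ge0 ?(ltW q0)//.
  have -> : (q ^+ i)%:E `^ r = ((q `^ r) ^+ i)%:E.
    by rewrite poweR_EFin exprn_powR// ltW.
  apply: (@nneseries_ge_term (fun i => ((q `^ r) ^+ i)%:E * u i `^ r)) => j.
  by rewrite mule_ge0 ?poweR_ge0// EFin_exp_ge0// powR_ge0.
have -> : ((1 - q)^-1 `^ r)%:E * Z = (((1 - q)^-1)%:E * Z `^ r^-1) `^ r.
  rewrite poweRM ?poweR_ge0 ?poweRVK// lee_fin invr_ge0; lra.
apply: le_poweR; first exact: ltW.
  by apply: nneseries_ge0 => i _ _; rewrite mule_ge0// EFin_exp_ge0// ltW.
rewrite (@eq_eseriesr _ _ (fun i => (q ^+ i)%:E * ((q ^+ i)%:E * u i))); last first.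
  by move=> i _; rewrite muleA -EFinM -exprMn qq.
apply: nneseries_geometric_le; rewrite ?q0// => i.
by rewrite qu mule_ge0// EFin_exp_ge0// ltW.
Qed.

End extended_powers.

Section lq_lemmas.
Context {R : realType}.
Local Open Scope ereal_scope.

(** [K] is nonempty because for [q = +oo] the supremum over the empty set is [-oo]. *)
Lemma lq_ge0 (J : choiceType) (K : set J) (q : \bar R) (u : J -> \bar R) :
  (forall j, 0 <= u j) -> K !=set0 -> 0 <= lq K q u.
Proof.
move=> u0 [j Kj]; case: q => [q||] //=; first exact: poweR_ge0.
by apply: (le_trans (u0 j)); apply: ereal_sup_ubound; exists j.
Qed.

Lemma le_lq (J : choiceType) (K : set J) (q : \bar R) (u v : J -> \bar R) :
  0 < q -> (forall j, K j -> 0 <= u j <= v j) -> lq K q u <= lq K q v.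
Proof.
case: q => [q||] //=.
  rewrite lte_fin => q0 uv; apply: le_poweR; first by rewrite invr_ge0 ltW.
    by apply: esum_ge0 => j Kj; exact: poweR_ge0.
  apply: le_esum => j /uv /andP[u0 ule].
  by apply: le_poweR => //; exact: ltW.
move=> _ uv; apply: ge_ereal_sup => _ [j Kj <-].
have /andP[_ ule] := uv j Kj.
by apply: (le_trans ule); apply: ereal_sup_ubound; exists j.
Qed.

(** One inequality is checked on finite partial sums; applied to [c^-1] and the family [c * u] it
    gives the other. *)
Lemma esumZl (J : choiceType) (K : set J) (c : R) (u : J -> \bar R) :
  (0 <= c)%R -> (forall j, 0 <= u j) ->
  \esum_(j in K) (c%:E * u j) = c%:E * \esum_(j in K) u j.
Proof.
have le_esumZl (a : R) v : (0 <= a)%R -> (forall j, 0 <= v j) ->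
    \esum_(j in K) (a%:E * v j) <= a%:E * \esum_(j in K) v j.
  move=> a0 v0; apply: ge_ereal_sup => _ [X [finX XK] <-].
  rewrite -ge0_mule_fsumr// lee_wpmul2l ?lee_fin//.
  by apply: ereal_sup_ubound; exists X.
rewrite le_eqVlt => /predU1P[<- u0|c0 u0].
  by rewrite mul0e esum1// => j _; rewrite mul0e.
apply/eqP; rewrite eq_le le_esumZl ?(ltW c0)//= -lee_pdivlMl//.
have cu0 j : 0 <= c%:E * u j by rewrite mule_ge0 ?u0// lee_fin ltW.
have c'0 : (0 <= c^-1)%R by rewrite invr_ge0 ltW.
apply: le_trans (le_esumZl _ _ c'0 cu0).
by apply: le_esum => j Kj; rewrite muleA -EFinM mulVf ?gt_eqF// mul1e.
Qed.

Lemma lqZl (J : choiceType) (K : set J) (q : \bar R) (c : R) (u : J -> \bar R) :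
  0 < q -> (0 <= c)%R -> (forall j, 0 <= u j) -> K !=set0 ->
  lq K q (fun j => c%:E * u j) = c%:E * lq K q u.
Proof.
case: q => [q||] //=.
  rewrite lte_fin => q0 c0 u0 _.
  under eq_esum do rewrite poweRM ?lee_fin//.
  rewrite esumZl ?powR_ge0//; last by move=> j; exact: poweR_ge0.
  rewrite poweRM ?lee_fin ?powR_ge0//; last first.
    by apply: esum_ge0 => j _; exact: poweR_ge0.
  by rewrite -poweR_EFin poweRK ?lee_fin.
move=> _ c0 u0 K0.
have lqZ (a : R) v : (0 <= a)%R -> (forall j, 0 <= v j) ->
   ereal_sup ((fun j => a%:E * v j) @` K) <= a%:E * ereal_sup (v @` K).
  move=> a0 v0; apply: ge_ereal_sup => _ [j Kj <-].
  by rewrite lee_wpmul2l ?lee_fin//; apply: ereal_sup_ubound; exists j.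
move: c0; rewrite le_eqVlt => /predU1P[<-|c0].
  rewrite mul0e; have [j Kj] := K0; apply/eqP; rewrite eq_le; apply/andP; split.
    by apply: ge_ereal_sup => _ [i Ki <-]; rewrite mul0e.
  by apply: ereal_sup_ubound; exists j => //; rewrite mul0e.
apply/eqP; rewrite eq_le lqZ ?(ltW c0)//= -lee_pdivlMl//.
have cu0 j : 0 <= c%:E * u j by rewrite mule_ge0 ?u0// lee_fin ltW.
have c'0 : (0 <= c^-1)%R by rewrite invr_ge0 ltW.
apply: le_trans (lqZ _ _ c'0 cu0).
apply: ge_ereal_sup => _ [j Kj <-]; apply: ereal_sup_ubound; exists j => //.
by rewrite muleA -EFinM mulVf ?gt_eqF// mul1e.
Qed.

Lemma subset_esum (J : choiceType) (K L : set J) (u : J -> \bar R) :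
  K `<=` L -> \esum_(j in K) u j <= \esum_(j in L) u j.
Proof.
move=> KL; apply: ge_ereal_sup => _ [X [finX XK] <-].
by apply: ereal_sup_ubound; exists X => //; split=> //; exact: subset_trans KL.
Qed.

Lemma esum_inj_le (J J' : choiceType) (e : J -> J') (u : J' -> \bar R) :
  injective e -> (forall j, 0 <= u j) ->
  \esum_(j in [set: J]) u (e j) <= \esum_(j in [set: J']) u j.
Proof.
move=> einj u0; rewrite -(@esum_image _ _ _ setT e u); last first.
  by move=> x y _ _; exact: einj.
exact: subset_esum.
Qed.

(* A discrete Young inequality, valid also for q < 1 because the kernel is
   geometric. *)
Lemma lq_convolution (q : \bar R) (t : R) : 0 < q -> (0 < t < 1)%R ->
  exists2 C : R, (0 < C)%R & forall (N : nat) (b : int -> \bar R),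
    (forall j, 0 <= b j) ->
    lq [set k : nat | (N < k)%N] q
       (fun k => \sum_(i <oo) (t ^+ i)%:E * b (k%:Z - i%:Z)%R)
    <= C%:E * lq [set: int] q b.
Proof.
case: q => [q||] //.
  rewrite lte_fin => q0 t01.
  have [C [k [C0 k01 HC]]] := geometric_poweR t01 q0.
  have [k0 k1] := andP k01.
  have k'0 : (0 < (1 - k)^-1)%R by rewrite invr_gt0 subr_gt0.
  exists ((C * (1 - k)^-1) `^ q^-1)%R; first exact/powR_gt0/mulr_gt0.
  move=> N b b0 /=.
  have bq0 j : 0 <= b j `^ q by exact: poweR_ge0.
  have S0 : 0 <= \esum_(j in [set: int]) b j `^ q by apply: esum_ge0.
  rewrite -poweR_EFin -poweRM// ?lee_fin ?mulr_ge0 ?(ltW C0) ?(ltW k'0)//.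
  apply: le_poweR; rewrite ?invr_ge0 ?(ltW q0)//.
    by apply: esum_ge0 => j _; exact: poweR_ge0.
  apply: le_trans (subset_esum _ (@subsetT _ _)) _.
  apply: (@le_trans _ _ (\esum_(n in [set: nat])
     (C%:E * \sum_(i <oo) (k ^+ i)%:E * b (n%:Z - i%:Z)%R `^ q))).
    by apply: le_esum => n _; apply: (HC (fun i => b (n%:Z - i%:Z)%R)) => i.
  have kb0 n i : 0 <= (k ^+ i)%:E * b (n%:Z - i%:Z)%R `^ q.
    by rewrite mule_ge0// EFin_exp_ge0// ltW.
  rewrite esumZl ?(ltW C0)//; last by move=> n; exact: nneseries_ge0.
  rewrite EFinM -muleA lee_wpmul2l ?lee_fin ?(ltW C0)//.
  rewrite -nneseries_esumT; last by move=> n; exact: nneseries_ge0.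
  rewrite (@nneseries_interchange _ (fun n i => (k ^+ i)%:E * b (n%:Z - i%:Z)%R `^ q) xpredT xpredT)//.
  under eq_eseriesr do rewrite nneseriesZl//.
  apply: nneseries_geometric_le => // i; rewrite nneseries_ge0//=.
  (* For fixed [i] the shift [n -> n - i] embeds the naturals into the integers, so each shifted sum
     is at most the sum over all integers. *)
  rewrite nneseries_esumT//.
  apply: (@esum_inj_le _ _ (fun n : nat => (n%:Z - i%:Z)%R) (fun j => b j `^ q)) => //.
  by move=> n m /addIr [].
move=> _ t01; have [t0 t1] := andP t01.
have t'0 : (0 < (1 - t)^-1)%R by rewrite invr_gt0 subr_gt0.
exists (1 - t)^-1%R => //= N b b0; apply: ge_ereal_sup => _ [n _ <-].
apply: nneseries_geometric_le => // i; rewrite b0/=.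
by apply: ereal_sup_ubound; exists (n%:Z - i%:Z)%R.
Qed.

(** Merges the nonnegative half of a two-sided sequence, whose quasi-norm is [h 0], and its negative
    terms into one geometric series, the form that can afterwards be integrated termwise. *)
Lemma lq_int_le (q : \bar R) (t : R) : 0 < q -> (0 < t < 1)%R ->
  exists C k : R, [/\ (0 < C)%R, (0 < k < 1)%R &
    forall (b : int -> \bar R) (h : nat -> \bar R),
    (forall j, 0 <= b j) -> (forall i, 0 <= h i) ->
    (forall m, b (Negz m) <= (t ^+ m.+1)%:E * h m.+1) ->
    h 0%N = lq [set: nat] q (fun j => b j%:Z) ->
    lq [set: int] q b <= C%:E * \sum_(i <oo) (k ^+ i)%:E * h i].
Proof.
case: q => [q||] //.
  rewrite lte_fin => q0 /andP[t0 t1].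
  have q'0 : (0 < q^-1)%R by rewrite invr_gt0.
  have tq : (0 < t `^ q < 1)%R.
    rewrite powR_gt0//=.
    have : (t `^ q < 1 `^ q)%R by rewrite gt0_ltr_powR// nnegrE ltW.
    by rewrite powR1.
  have [C [k [C0 k01 HC]]] := geometric_poweR tq q'0.
  exists C, k; split => // b h b0 h0 bh h0E /=.
  (* The exponent [1/q] is applied to the series of [h i ^ q] with ratio [t^q]: its term 0 is the
     sum over the nonnegative integers, its term [m + 1] bounds the contribution of [Negz m], that
     is, of [-(m + 1)]. *)
  have := HC (fun i => h i `^ q) (fun i => poweR_ge0 _ _).
  under [in X in _ <= X -> _]eq_eseriesr do rewrite poweRK//.
  apply: le_trans; apply: le_poweR; rewrite ?(ltW q'0)//.
    by apply: esum_ge0 => j _; exact: poweR_ge0.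
  have bq0 j : 0 <= b j `^ q by exact: poweR_ge0.
  rewrite (esumID (range Posz))//.
  rewrite nneseries_recl//; last first.
    by move=> i; rewrite mule_ge0 ?poweR_ge0// EFin_exp_ge0// powR_ge0.
  rewrite expr0 mul1e h0E /= poweRVK//; last by apply: esum_ge0.
  rewrite setTI esum_image; last by move=> x y _ _ [].
  rewrite leeD2l// (_ : _ `&` _ = range Negz); last first.
    by apply/seteqP; split=> [[n|n]|j [n _ <-]] //=;
      [case=> _ []; exists n|exists n|split=> // -[m _]].
  rewrite esum_image; last by move=> x y _ _ [].
  rewrite -nneseries_esumT//.
  rewrite -(nneseries_addn 1%N); last first.
    by move=> i; rewrite mule_ge0 ?poweR_ge0// EFin_exp_ge0// powR_ge0.
  apply: lee_nneseries => // m _; rewrite addn1.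
  apply: le_trans (le_poweR (ltW q0) (b0 _) (bh m)) _.
  rewrite poweRM// ?EFin_exp_ge0 ?(ltW t0)// lee_wpmul2r ?poweR_ge0//.
  by rewrite poweR_EFin exprn_powR// ltW.
move=> _ t01; have [t0 t1] := andP t01; exists 1%R, t; split=> // b h b0 h0 bh h0E.
rewrite mul1e /=; apply: ge_ereal_sup => _ [[n|n] _ <-].
  apply: (@le_trans _ _ ((t ^+ 0)%:E * h 0%N)).
    by rewrite expr0 mul1e h0E; apply: ereal_sup_ubound; exists n.
  apply: (@nneseries_ge_term _ (fun i => (t ^+ i)%:E * h i)) => i.
  by rewrite mule_ge0// EFin_exp_ge0// ltW.
apply: (le_trans (bh n)).
apply: (@nneseries_ge_term _ (fun i => (t ^+ i)%:E * h i)) => i.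
by rewrite mule_ge0// EFin_exp_ge0// ltW.
Qed.

End lq_lemmas.

(** * Norms and averages *)

Section integral_lemmas.
Context {R : realType} {disp : measure_display} {X : measurableType disp}.
Variable mu : {measure set X -> \bar R}.
Local Open Scope ereal_scope.

(* Unlike [ge0_le_integral], no measurability is needed: the integral of a
   nonnegative function is a supremum over the simple functions below it. *)
Lemma le_integral_ge0 (D : set X) (f g : X -> \bar R) :
  (forall x, D x -> 0 <= f x <= g x) ->
  \int[mu]_(x in D) f x <= \int[mu]_(x in D) g x.
Proof.
move=> fg.
rewrite !ge0_integralE; last 2 first.
- by move=> x /fg /andP[]; exact: le_trans.
- by move=> x /fg /andP[].
apply: ereal_sup_le => _ [h hf <-]; exists h => // x.
apply: (le_trans (hf x)); rewrite /patch; case: ifPn => //.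
by rewrite inE => /fg /andP[].
Qed.

Lemma le_Lnorm (p : \bar R) (f g : X -> \bar R) : 0 < p ->
  (forall x, 0 <= f x <= g x) -> 'N[mu]_p[f] <= 'N[mu]_p[g].
Proof.
move=> p0 fg; have fgabs x : `|f x| <= `|g x|.
  by have /andP[f0 fg'] := fg x; rewrite !gee0_abs// (le_trans f0).
rewrite unlock; case: p p0 => [p||] //=.
  rewrite lte_fin => p0; apply: le_poweR; first by rewrite invr_ge0 ltW.
    by apply: integral_ge0 => x _; exact: poweR_ge0.
  apply: le_integral_ge0 => x _; rewrite poweR_ge0/= le_poweR// ltW//.
by move=> _; case: ifPn => // mu0; apply: le_ess_sup; exact: nearW.
Qed.

Lemma ge0_LnormZ (p : \bar R) (c : R) (f : X -> \bar R) : 0 < p -> (0 <= c)%R ->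
  measurable_fun setT f -> (forall x, 0 <= f x) ->
  'N[mu]_p[(fun x => c%:E * f x)] = c%:E * 'N[mu]_p[f].
Proof.
move=> p0 c0 mf f0; rewrite unlock; case: p p0 => [p||] //=.
  rewrite lte_fin => p0.
  under eq_integral do rewrite gee0_abs ?mule_ge0 ?lee_fin// poweRM ?lee_fin//.
  rewrite ge0_integralZl_EFin//; last 3 first.
  - by move=> x _; exact: poweR_ge0.
  - exact: (measurableT_comp (measurable_poweR _)).
  - exact: powR_ge0.
  under [in RHS]eq_integral do rewrite gee0_abs//.
  rewrite poweRM ?lee_fin ?powR_ge0//; last first.
    by apply: integral_ge0 => x _; exact: poweR_ge0.
  by rewrite -poweR_EFin poweRK ?lee_fin.
move=> _; case: ifPn => mu0; last by rewrite mule0.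
rewrite -ess_supZl//; apply: eq_ess_sup; apply: nearW => x /=.
by rewrite abseM gee0_abs ?lee_fin.
Qed.

(** Replaces the infinite triangle inequality. For finite [p], [geometric_poweR] is used twice:
    pointwise with exponent [p], and, after termwise integration, with exponent [1/p]. For [p = +oo]
    the countably many exceptional null sets are united. *)
Lemma Lnorm_geometric (p : \bar R) (t : R) : 0 < p -> (0 < t < 1)%R ->
  exists C k : R, [/\ (0 < C)%R, (0 < k < 1)%R &
    forall h : nat -> X -> \bar R, (forall i, measurable_fun setT (h i)) ->
    (forall i x, 0 <= h i x) ->
    'N[mu]_p[(fun x => \sum_(i <oo) (t ^+ i)%:E * h i x)] <=
      C%:E * \sum_(i <oo) (k ^+ i)%:E * 'N[mu]_p[h i]].
Proof.
case: p => [p||] //.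
  rewrite lte_fin => p0 t01.
  have [C [k [C0 k01 HC]]] := geometric_poweR t01 p0.
  have [k0 k1] := andP k01.
  have p'0 : (0 < p^-1)%R by rewrite invr_gt0.
  have [C' [k' [C'0 k'01 HC']]] := geometric_poweR k01 p'0.
  have k'0 : (0 <= k')%R by case/andP: k'01 => /ltW.
  exists (C `^ p^-1 * C')%R, k'; split=> //; first exact/mulr_gt0/C'0/powR_gt0.
  move=> h mh h0; have tp0 i x : 0 <= (t ^+ i)%:E * h i x.
    by rewrite mule_ge0// EFin_exp_ge0//; case/andP: t01 => /ltW.
  have hp0 i x : 0 <= (k ^+ i)%:E * h i x `^ p.
    by rewrite mule_ge0 ?poweR_ge0// EFin_exp_ge0// ltW.
  have mhp i : measurable_fun setT (fun x => h i x `^ p).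
    exact: (measurableT_comp (measurable_poweR _)).
  apply: (@le_trans _ _ ((\int[mu]_x (C%:E * \sum_(i <oo) (k ^+ i)%:E * h i x `^ p)) `^ p^-1)).
    rewrite unlock /=; apply: le_poweR; first exact: ltW.
      by apply: integral_ge0 => x _; exact: poweR_ge0.
    apply: le_integral_ge0 => x _; rewrite poweR_ge0/= gee0_abs ?nneseries_ge0//.
    exact: (HC (h ^~ x)).
  rewrite ge0_integralZl_EFin//; last 3 first.
  - by move=> x _; rewrite nneseries_ge0.
  - apply: ge0_emeasurable_sum => i; first by move=> x _ _.
    by move=> _; exact: measurable_funeM.
  - exact: ltW.
  rewrite integral_nneseries//; last by move=> i; exact: measurable_funeM.
  under eq_eseriesr => i _.
    rewrite ge0_integralZl_EFin//; last 2 first.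
    - by move=> x _; exact: poweR_ge0.
    - by rewrite exprn_ge0// ltW.
    over.
  rewrite poweRM ?lee_fin ?(ltW C0)//; last first.
    apply: nneseries_ge0 => i _ _; rewrite mule_ge0 ?EFin_exp_ge0 ?(ltW k0)//.
    by apply: integral_ge0 => x _; exact: poweR_ge0.
  rewrite EFinM -muleA lee_wpmul2l ?lee_fin ?powR_ge0//.
  apply: (le_trans (HC' _ _)).
    by move=> i; apply: integral_ge0 => x _; exact: poweR_ge0.
  rewrite lee_wpmul2l ?lee_fin ?(ltW C'0)//.
  apply: lee_nneseries => i _.
    by rewrite mule_ge0 ?poweR_ge0// EFin_exp_ge0.
  rewrite lee_wpmul2l ?EFin_exp_ge0//.
  rewrite unlock /=; under [in leRHS]eq_integral do rewrite gee0_abs//.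
  exact: lexx.
move=> _ t01; have [t0 t1] := andP t01; exists 1%R, t; split=> // h mh h0.
rewrite mul1e unlock /=; case: ifPn => mu0; last first.
  by rewrite nneseries_ge0// => i _ _; rewrite mule0.
apply/ess_supP; near=> x.
rewrite /= gee0_abs; last first.
  by apply: nneseries_ge0 => i _ _; rewrite mule_ge0// EFin_exp_ge0// ltW.
apply: lee_nneseries => i _; first by rewrite mule_ge0// EFin_exp_ge0// ltW.
rewrite lee_wpmul2l ?EFin_exp_ge0 ?(ltW t0)//.
rewrite -(gee0_abs (h0 i x)); move: i; near: x.
by apply/ae_foralln => i; exact: ess_sup_ge.
Unshelve. all: by end_near. Qed.

Lemma Lnorm_geometric_lty (p : \bar R) (t C M : R) (h : nat -> X -> \bar R)
    (g : X -> \bar R) : 0 < p -> (0 < t < 1)%R -> (0 <= C)%R ->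
  (forall i, measurable_fun setT (h i)) -> (forall i x, 0 <= h i x) ->
  (forall i, 'N[mu]_p[h i] <= M%:E) ->
  (forall x, 0 <= g x <= C%:E * \sum_(i <oo) (t ^+ i)%:E * h i x) ->
  'N[mu]_p[g] < +oo.
Proof.
move=> p0 t01 C0 mh h0 hM gh; have [t0 t1] := andP t01.
have th0 i x : 0 <= (t ^+ i)%:E * h i x by rewrite mule_ge0// EFin_exp_ge0// ltW.
apply: (le_lt_trans (le_Lnorm p0 gh)).
rewrite ge0_LnormZ//; last 2 first.
- apply: ge0_emeasurable_sum => i; first by move=> x _ _.
  by move=> _; exact: measurable_funeM.
- by move=> x; exact: nneseries_ge0.
have [C' [k [C'0 k01 HC]]] := Lnorm_geometric p0 t01.
apply: (@le_lt_trans _ _ (C%:E * (C'%:E * (((1 - k)^-1)%:E * M%:E)))); last first.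
  by rewrite -!EFinM ltry.
rewrite lee_wpmul2l// (le_trans (HC _ _ _))// lee_wpmul2l ?lee_fin ?(ltW C'0)//.
by apply: nneseries_geometric_le => // i; rewrite Lnorm_ge0 hM.
Qed.

End integral_lemmas.

(** * Jensen's inequality for averages *)

Section averages.
Context {R : realType} {disp : measure_display} {X : measurableType disp}.
Local Open Scope ereal_scope.

Lemma le_poweR_add (a b : \bar R) (p : R) : (0 <= p)%R -> 0 <= a -> 0 <= b ->
  (a + b) `^ p <= (2 `^ p)%:E * (a `^ p + b `^ p).
Proof.
move=> p0 a0 b0; wlog ab : a b a0 b0 / a <= b => [hw|].
  have /orP[|] := le_total a b; first exact: hw.
  by move=> ba; rewrite addeC [in leRHS]addeC; exact: hw.
apply: (@le_trans _ _ ((2%:E * b) `^ p)).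
  by apply: le_poweR; rewrite ?adde_ge0// mule_natl mule2n leeD2r.
rewrite poweRM ?lee_fin// lee_wpmul2l ?lee_fin ?powR_ge0//.
by rewrite leeDr// poweR_ge0.
Qed.

(** Above the threshold [c] one has [t^(1-p) <= c^(1-p)], because [p >= 1]. The bound is affine in
    [t^p], so it can be averaged, and [c] remains free. *)
Lemma le_cut_poweR (t : \bar R) (c p : R) : 0 <= t -> (0 < c)%R -> (1 <= p)%R ->
  t <= (c `^ (1 - p))%:E * t `^ p + c%:E.
Proof.
move=> t0 c0 p1; have [tc|ct] := leP t c%:E.
  by apply: (le_trans tc); rewrite leeDr// mule_ge0 ?poweR_ge0// lee_fin powR_ge0.
apply: (@le_trans _ _ ((c `^ (1 - p))%:E * t `^ p)); last by rewrite leeDl// lee_fin ltW.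
case: t t0 ct => [t||] //= t0; last first.
  by move=> _; rewrite gt_eqF ?(lt_le_trans ltr01)// gt0_muley ?leey// lte_fin powR_gt0.
rewrite lte_fin lee_fin => ct.
have t'0 : (0 < t)%R by exact: lt_trans ct.
rewrite -[leLHS](_ : (t `^ (1 - p) * t `^ p = _)%R); last first.
  by rewrite -powRD ?subrK ?powRr1 ?ltW// oner_eq0.
rewrite ler_wpM2r ?powR_ge0//.
have -> : (1 - p = - (p - 1))%R by rewrite opprB.
rewrite !powRN lef_pV2 ?posrE ?powR_gt0//.
by rewrite ge0_ler_powR ?nnegrE ?subr_ge0 ?(ltW c0) ?(ltW t'0) ?(ltW ct).
Qed.

Variable mu : {measure set X -> \bar R}.

Lemma emean_ge0 (E : set X) (g : X -> \bar R) :
  (forall x, E x -> 0 <= g x) -> 0 <= emean mu E g.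
Proof.
by move=> g0; rewrite mule_ge0 ?lee_fin ?invr_ge0 ?fine_ge0// integral_ge0.
Qed.

Lemma le_emean (E : set X) (f g : X -> \bar R) :
  (forall x, E x -> 0 <= f x <= g x) -> emean mu E f <= emean mu E g.
Proof.
move=> fg; rewrite lee_wpmul2l ?lee_fin ?invr_ge0 ?fine_ge0//.
exact: le_integral_ge0.
Qed.

Lemma emeanD (E : set X) (f g : X -> \bar R) : measurable E ->
  measurable_fun E f -> measurable_fun E g ->
  (forall x, E x -> 0 <= f x) -> (forall x, E x -> 0 <= g x) ->
  emean mu E (fun x => f x + g x) = emean mu E f + emean mu E g.
Proof.
move=> mE mf mg f0 g0; rewrite /emean ge0_integralD// ge0_muleDr ?integral_ge0//.
Qed.

Lemma emeanZ (E : set X) (c : R) (f : X -> \bar R) : measurable E ->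
  measurable_fun E f -> (0 <= c)%R -> (forall x, E x -> 0 <= f x) ->
  emean mu E (fun x => c%:E * f x) = c%:E * emean mu E f.
Proof. by move=> mE mf c0 f0; rewrite /emean ge0_integralZl_EFin// muleCA. Qed.

Lemma emean_cst (E : set X) (c : \bar R) : measurable E -> 0 < mu E < +oo ->
  emean mu E (fun=> c) = c.
Proof.
move=> mE /andP[E0 Ey]; rewrite /emean integral_cst//.
have Ef : mu E \is a fin_num by rewrite ge0_fin_numE.
rewrite muleCA -[X in _ * (_ * X)]fineK// -EFinM mulVf ?mule1//.
by rewrite gt_eqF// fine_gt0// E0.
Qed.

(* Jensen's inequality up to a constant: integrate [t <= c^(1-p) t^p + c] and
   optimize in [c]. *)
Lemma emean_poweR (E : set X) (g : X -> \bar R) (p : R) : measurable E ->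
  0 < mu E < +oo -> measurable_fun E g -> (forall x, 0 <= g x) -> (1 <= p)%R ->
  emean mu E g `^ p <= (2 `^ p)%:E * emean mu E (fun x => g x `^ p).
Proof.
move=> mE Ef mg g0 p1; have p0 : (0 < p)%R by exact: lt_le_trans p1.
have gp0 x : 0 <= g x `^ p by exact: poweR_ge0.
have mgp : measurable_fun E (fun x => g x `^ p).
  exact: (measurableT_comp (measurable_poweR _)).
set b := emean mu E (fun x => g x `^ p).
have b0 : 0 <= b by exact: emean_ge0.
have key (c : R) : (0 < c)%R -> emean mu E g <= (c `^ (1 - p))%:E * b + c%:E.
  move=> c0; rewrite -emeanZ ?powR_ge0// -(emean_cst c%:E mE Ef) -emeanD//.
  - by apply: le_emean => x _; rewrite g0/= le_cut_poweR.
  - exact: measurable_funeM.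
  - by move=> x _; rewrite mule_ge0 ?lee_fin ?powR_ge0.
  - by move=> x _; rewrite lee_fin ltW.
have [b_eq0|b_neq0] := eqVneq b 0.
  (* With [b = 0] the bound [key] reduces to [c], and [c] is arbitrarily small. *)
  have : emean mu E g <= 0.
    apply/lee_addgt0Pr => e e0; rewrite add0e.
    by have := key e e0; rewrite b_eq0 mule0 add0e.
  move=> m0; have -> : emean mu E g = 0.
    by apply/eqP; rewrite eq_le m0 emean_ge0.
  by rewrite poweR0r ?gt_eqF// mule_ge0 ?lee_fin ?powR_ge0.
have [->|b_neqy] := eqVneq b +oo.
  by rewrite gt0_muley ?leey// lte_fin powR_gt0.
have bf : b \is a fin_num by rewrite ge0_fin_numE// ltey.
have b_gt0 : (0 < fine b)%R by rewrite fine_gt0// lt0e b_neq0 b0 ltey.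
(* The choice [c = b^(1/p)] makes both terms of [key] equal to [b^(1/p)]. *)
have c0 : (0 < fine b `^ p^-1)%R by rewrite powR_gt0.
have -> : (2 `^ p)%:E * b = (2%:E * b `^ p^-1) `^ p.
  by rewrite poweRM ?lee_fin ?poweR_ge0// poweRVK.
apply: le_poweR; rewrite ?(ltW p0) ?emean_ge0//.
apply: (le_trans (key _ c0)).
rewrite -[in leLHS](fineK bf) -[in leRHS](fineK bf) -EFinM -EFinD lee_fin.
rewrite -powRrM -[X in (_ * X)%R](powRr1 (ltW b_gt0)) -powRD; last first.
  by rewrite (gt_eqF b_gt0) implybT.
rewrite mulrBr mulr1 mulVf ?gt_eqF// subrK; lra.
Qed.

End averages.

(** * Averages over a measurable family of sets *)

Section sigma_finite_averages.
Context {R : realType} {disp : measure_display} {X : measurableType disp}.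
Variable mu : {sigma_finite_measure set X -> \bar R}.
Variable P : X -> set X.
Hypothesis mP : measurable [set u : X * X | P u.1 u.2].
Hypothesis Pfin : forall x, (0 < mu (P x) < +oo)%E.
Local Open Scope ereal_scope.

Let W := [set u : X * X | P u.1 u.2].

Lemma measurable_section (x : X) : measurable (P x).
Proof.
have := measurable_xsection x mP; congr measurable.
by apply/seteqP; split=> y; rewrite /xsection /= inE.
Qed.

Lemma section_integral (F : X * X -> \bar R) (x : X) :
  \int[mu]_(y in P x) F (x, y) = \int[mu]_y (F \_ W) (x, y).
Proof.
rewrite integral_mkcond; apply: eq_integral => y _; rewrite /patch.
by congr (if _ then _ else _); rewrite /W /= !inE /= asboolE.
Qed.

Lemma measurable_inv_measure :
  measurable_fun setT (fun x => ((fine (mu (P x)))^-1)%:E).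
Proof.
have -> : (fun x => ((fine (mu (P x)))^-1)%:E) = (fun x => mu (P x) `^ (-1)).
  apply/funext => x; have /andP[P0 Py] := Pfin x.
  by rewrite poweRN ?ge0_fin_numE// powRr1// fine_ge0.
apply: (measurableT_comp (measurable_poweR _)).
have := measurable_fun_xsection mu mP; congr measurable_fun.
apply/funext => x /=; congr (mu _).
by apply/seteqP; split=> y; rewrite /xsection /= inE.
Qed.

Lemma measurable_emean (F : X * X -> \bar R) :
  measurable_fun setT F -> (forall u, 0 <= F u) ->
  measurable_fun setT (fun x => emean mu (P x) (fun y => F (x, y))).
Proof.
move=> mF F0; apply: emeasurable_funM; first exact: measurable_inv_measure.
under eq_fun do rewrite section_integral.
apply: (measurable_fun_fubini_tonelli_F (F \_ W)).
  by apply/(measurable_restrictT _ mP); exact: measurable_funTS.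
by move=> u; exact: erestrict_ge0.
Qed.

(** By Tonelli's theorem [g y] acquires the factor given by the integral of [1 / mu (P x)] over the
    [x] with [y] in [P x]. These [x] lie in [S], where the integrand is at most [C / mu S], so the
    factor is at most [C]. *)
Lemma integral_emean_le (C : R) (g : X -> \bar R) : (0 <= C)%R ->
  (forall y, exists S, [/\ measurable S, 0 < mu S < +oo &
     forall x, P x y -> S x /\ mu S <= C%:E * mu (P x)]) ->
  measurable_fun setT g -> (forall x, 0 <= g x) ->
  \int[mu]_x emean mu (P x) g <= C%:E * \int[mu]_x g x.
Proof.
move=> C0 HS mg g0.
pose v x := ((fine (mu (P x)))^-1)%:E.
have v0 x : 0 <= v x by rewrite lee_fin invr_ge0 fine_ge0.
pose F (u : X * X) := v u.1 * ((fun u : X * X => g u.2) \_ W) u.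
have gW0 u : 0 <= ((fun u : X * X => g u.2) \_ W) u by exact: erestrict_ge0.
have mgW : measurable_fun setT ((fun u : X * X => g u.2) \_ W).
  apply/(measurable_restrictT _ mP); apply: measurable_funTS.
  exact: (measurableT_comp mg).
have mF : measurable_fun setT F.
  apply: emeasurable_funM => //.
  exact: (measurableT_comp measurable_inv_measure).
have F0 u : 0 <= F u by exact: mule_ge0.
have -> : \int[mu]_x emean mu (P x) g = \int[mu]_x \int[mu]_y F (x, y).
  apply: eq_integral => x _; rewrite /emean (section_integral (fun u => g u.2)).
  rewrite -/(v x) /F /= ge0_integralZl//.
  exact: (measurableT_comp mgW).
rewrite fubini_tonelli// -ge0_integralZl//.
apply: ge0_le_integral => //.
- by move=> y _; exact: integral_ge0.
- exact: (measurable_fun_fubini_tonelli_G F).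
- exact: measurable_funeM.
move=> y _; have [S [mS /andP[S0 Sy] HSy]] := HS y.
have Sf : mu S \is a fin_num by rewrite ge0_fin_numE.
pose c := (C / fine (mu S))%R.
have c0 : (0 <= c)%R by rewrite divr_ge0// fine_ge0.
apply: (@le_trans _ _ (\int[mu]_(x in S) (c%:E * g y))); last first.
  rewrite integral_cst// muleAC -[X in _ * X * _]fineK// -EFinM divfK//.
  by rewrite gt_eqF// fine_gt0// S0.
rewrite [leRHS]integral_mkcond; apply: le_integral_ge0 => x _.
rewrite F0/= /F /patch /W; case: ifPn; rewrite ?inE /=; last first.
  by rewrite mule0 => _; case: ifPn => // _; rewrite mule_ge0.
move=> Pxy; have [Sx hS] := HSy x Pxy; rewrite mem_set//.
rewrite lee_wpmul2r// lee_fin /c.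
have /andP[P0 Py] := Pfin x.
have Pf : mu (P x) \is a fin_num by rewrite ge0_fin_numE.
rewrite ler_pdivlMr; last by rewrite fine_gt0// S0.
rewrite mulrC ler_pdivrMr; last by rewrite fine_gt0// P0.
by rewrite -lee_fin EFinM !fineK.
Qed.

(** For the family [P] at scale [delta^j] this is the [U_j] of the overview. *)
Definition mosc (f : X -> R) (x : X) : \bar R :=
  emean mu (P x) (fun y => `|f x - f y|%:E).

Lemma mosc_ge0 f x : 0 <= mosc f x.
Proof. by apply: emean_ge0 => y _; rewrite lee_fin. Qed.

Lemma measurable_mosc f : measurable_fun setT f -> measurable_fun setT (mosc f).
Proof.
move=> mf; apply: (measurable_emean (F := fun u => `|f u.1 - f u.2|%:E)) => //.
apply/measurable_EFinP; apply: measurableT_comp => //.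
by apply: measurable_funB; exact: (measurableT_comp mf).
Qed.

(** For finite [p], Jensen's inequality and the bound for powers of sums give
    [mosc^p <= 4^p (|f|^p + mean of |f|^p)], and [integral_emean_le] integrates the mean. The
    constant is generous: the root of [4^p] is 4 and [(1 + C)^(1/p) <= 1 + C], while for [p = +oo]
    the factor 2 is enough. *)
Lemma Lnorm_mosc_le (C : R) (f : X -> R) (p : \bar R) : (0 <= C)%R -> 1 <= p ->
  (forall y, exists S, [/\ measurable S, 0 < mu S < +oo &
     forall x, P x y -> S x /\ mu S <= C%:E * mu (P x)]) ->
  measurable_fun setT f ->
  'N[mu]_p[mosc f] <= (16 * (1 + C))%:E * 'N[mu]_p[EFin \o f].
Proof.
move=> C0 p1 HS mf.
have mfE : measurable_fun setT (EFin \o f) by exact/measurable_EFinP.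
rewrite unlock; case: p p1 => [p||] //=.
  rewrite lee_fin => p1; have p0 : (0 < p)%R by exact: lt_le_trans p1.
  pose fp x : \bar R := (`|f x| `^ p)%:E.
  have mfp : measurable_fun setT fp.
    apply/measurable_EFinP; apply: (measurableT_comp (measurable_powR p)).
    exact: measurableT_comp.
  have fp0 x : 0 <= fp x by rewrite lee_fin powR_ge0.
  have mA : measurable_fun setT (fun x => emean mu (P x) fp).
    apply: (measurable_emean (F := fun u => fp u.2)) => //.
    exact: (measurableT_comp mfp).
  have A0 x : 0 <= emean mu (P x) fp by exact: emean_ge0.
  have pw x : mosc f x `^ p <=
      (2 `^ p * 2 `^ p)%:E * (fp x + emean mu (P x) fp).
    have mPx := measurable_section x.
    have mfPx : measurable_fun (P x) (fun y => `|f x - f y|%:E).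
      apply/measurable_EFinP; apply: measurableT_comp => //.
      by apply: measurable_funTS; exact: measurable_funB.
    apply: (le_trans (emean_poweR mPx (Pfin x) mfPx _ p1)) => //.
    rewrite EFinM -muleA lee_wpmul2l ?lee_fin ?powR_ge0//.
    have mfpP : measurable_fun (P x) fp by exact: measurable_funTS.
    rewrite -[X in X + _](emean_cst _ mPx (Pfin x)) -emeanD// -emeanZ ?powR_ge0//; last 2 first.
    - exact: emeasurable_funD.
    - by move=> y _; rewrite adde_ge0.
    apply: le_emean => y _; rewrite lee_fin powR_ge0/=.
    have := @le_poweR_add R `|f x|%:E `|f y|%:E p (ltW p0).
    rewrite !lee_fin => /(_ (normr_ge0 _) (normr_ge0 _)); apply: le_trans.
    by rewrite ge0_ler_powR ?nnegrE ?addr_ge0 ?(ltW p0) ?ler_normB.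
  apply: (@le_trans _ _ (((2 `^ p * 2 `^ p)%:E * ((1 + C)%:E * \int[mu]_x fp x)) `^ p^-1)).
    apply: le_poweR; first by rewrite invr_ge0 ltW.
      by apply: integral_ge0 => x _; exact: poweR_ge0.
    apply: (@le_trans _ _ (\int[mu]_x ((2 `^ p * 2 `^ p)%:E *
        (fp x + emean mu (P x) fp)))).
      by apply: le_integral_ge0 => x _; rewrite poweR_ge0/= gee0_abs ?mosc_ge0.
    rewrite ge0_integralZl_EFin ?mulr_ge0 ?powR_ge0//; last 2 first.
    - by move=> x _; rewrite adde_ge0.
    - exact: emeasurable_funD.
    rewrite lee_wpmul2l ?lee_fin ?mulr_ge0 ?powR_ge0//.
    rewrite ge0_integralD// EFinD ge0_muleDl ?lee_fin// mul1e leeD2l//.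
    exact: integral_emean_le.
  have I0 : 0 <= \int[mu]_x fp x by exact: integral_ge0.
  have C1 : (0 <= 1 + C)%R by rewrite addr_ge0.
  rewrite muleA -EFinM poweRM ?lee_fin ?mulr_ge0 ?powR_ge0//.
  rewrite lee_wpmul2r ?poweR_ge0// lee_fin !powRM ?mulr_ge0 ?powR_ge0//.
  rewrite -!powRrM divff ?gt_eqF// powRr1// ler_pM ?mulr_ge0 ?powR_ge0//; first by lra.
  have := @ler1_powR R (1 + C) p^-1; apply; first by lra.
  by rewrite invf_le1.
move=> _; case: ifPn => mu0; last by rewrite mule0.
set M := (X in _ <= _ * X).
have M0 : 0 <= M by apply: ess_sup_gee => //; apply: nearW => x; exact: abse_ge0.
apply: (@le_trans _ _ (2%:E * M)); last first.
  by rewrite lee_wpmul2r// lee_fin; lra.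
have aeM : \forall x \ae mu, `|(f x)%:E| <= M.
  exact: (@ess_sup_ge _ _ _ mu (abse \o (EFin \o f))).
apply/ess_supP; apply: filterS aeM => x fxM.
rewrite /= gee0_abs ?mosc_ge0// -(emean_cst (2%:E * M) (measurable_section x) (Pfin x)).
rewrite lee_wpmul2l ?lee_fin ?invr_ge0 ?fine_ge0//.
have mPx := measurable_section x.
apply: ae_ge0_le_integral => //.
- apply/measurable_EFinP; apply: measurableT_comp => //.
  by apply: measurable_funTS; exact: measurable_funB.
- by move=> y _; rewrite mule_ge0.
have aeM : \forall x \ae mu, `|(f x)%:E| <= M.
  exact: (@ess_sup_ge _ _ _ mu (abse \o (EFin \o f))).
apply: filterS aeM => y fyM _; rewrite mule_natl mule2n.
by apply: le_trans (leeD fxM fyM); rewrite lee_fin ler_normB.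
Qed.

End sigma_finite_averages.

(** * Spaces of homogeneous type *)

Section countable_measurable.
Context {R : realType} {disp : measure_display} {X : measurableType disp}.

Lemma countable_bigcup_measurable (J : Type) (K : set J) (F : J -> set X) :
  countable K -> (forall j, K j -> measurable (F j)) ->
  measurable (\bigcup_(j in K) F j).
Proof.
move=> cK mF; rewrite bigcup_set_type.
apply: countable_bigcupT_measurable; first by rewrite (eq_countable (card_setT K)).
by move=> [j jK]; apply: mF; exact: set_mem jK.
Qed.

Variable mu : {measure set X -> \bar R}.
Local Open Scope ereal_scope.

(** For each [n], only finitely many of the disjoint sets can have mass above [1/(n+1)] inside the
    set [B] of finite measure. *)
Lemma countable_positive_measure (J : choiceType) (K : set J) (F : J -> set X)
    (B : set X) : measurable B -> mu B < +oo ->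
  (forall j, K j -> measurable (F j)) -> trivIset K F ->
  countable [set j | K j /\ 0 < mu (F j `&` B)].
Proof.
move=> mB By mF tF.
have Bf : mu B \is a fin_num by rewrite ge0_fin_numE.
have FBf j : K j -> mu (F j `&` B) \is a fin_num.
  move=> Kj; rewrite ge0_fin_numE//; apply: le_lt_trans By.
  by apply: le_measure; rewrite ?inE//; apply: measurableI => //; exact: mF.
rewrite (_ : mkset _ =
    \bigcup_n [set j | K j /\ n.+1%:R^-1%:E < mu (F j `&` B)]); last first.
  apply/seteqP; split=> j /=.
    move=> [Kj]; rewrite -(fineK (FBf j Kj)) lte_fin => /ltr_add_invr[n].
    by rewrite add0r => nj; exists n => //; split => //; rewrite -(fineK (FBf j Kj)) lte_fin.
  by move=> [n _ [Kj]] h; split => //; apply: lt_trans h; rewrite lte_fin invr_gt0.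
apply: bigcup_countable => // n _; apply: finite_set_countable.
apply: contrapT => Kinf.
(* Since [m > mu B * (n + 1)], [m] disjoint pieces of mass above [1/(n+1)] would exceed [mu B]. *)
pose m := (Num.truncn (fine (mu B) * n.+1%:R)).+1.
have [G GK Gm] := infinite_set_fset m Kinf.
have mFG j : [set` G] j -> measurable (F j `&` B).
  by move=> /GK [Kj _]; apply: measurableI => //; exact: mF.
have finG : finite_set [set` G] by exact: finite_fset.
have tFG : trivIset [set` G] (fun j => F j `&` B).
  move=> i j /GK[Ki _] /GK[Kj _] [x [[Fi _] [Fj _]]].
  by apply: tF => //; exists x.
have : mu (\bigcup_(j in [set` G]) (F j `&` B)) <= mu B.
  apply: le_measure; rewrite ?inE//; first exact: fin_bigcup_measurable.
  by apply: bigcup_sub => k _; exact: subIsetr.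
apply/negP; rewrite -ltNge measure_fin_bigcup// fsbig_finite//= set_fsetK.
apply: (@lt_le_trans _ _ (\sum_(j <- G) (n.+1%:R^-1)%:E)); last first.
  rewrite big_seq [leRHS]big_seq; apply: lee_sum => j jG.
  by have [_ /ltW] := GK j jG.
rewrite sumEFin -(fineK Bf) lte_fin big_const_seq count_predT iter_addr_0.
rewrite -[ltRHS]mulr_natr mulrC ltr_pdivlMr//.
by apply: (lt_le_trans (truncnS_gt _)); rewrite ler_nat.
Qed.

End countable_measurable.

Lemma exists_expr_lt {R : realType} (t e : R) : 0 < t < 1 -> 0 < e ->
  exists n, t ^+ n < e.
Proof.
move=> /andP[t0 t1] e0.
have : geometric 1 t n @[n --> \oo] --> 0.
  by apply: cvg_geometric; rewrite ger0_norm// ltW.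
move=> /cvgr0_norm_lt /(_ e e0) [n _ /(_ n (leqnn n))].
by rewrite /= mul1r ger0_norm ?exprn_ge0 ?(ltW t0)// => ?; exists n.
Qed.

(** * Balls and dyadic cubes *)

Section geometry.
Context {R : realType} {disp : measure_display} {X : measurableType disp}.
Variables (d : X -> X -> R) (mu : {measure set X -> \bar R}) (A0 Cmu : R).
Hypothesis hd : quasi_metric d A0.
Hypothesis hmu : homogeneous_type d mu Cmu.

Lemma qball_measurable x r : 0 < r -> measurable (qball d x r).
Proof. by case: hmu => _ h _ _; exact: h. Qed.

Lemma qball_fin x r : 0 < r -> (0 < mu (qball d x r) < +oo)%E.
Proof. by case: hmu => _ _ h _; exact: h. Qed.

Lemma qball_fin_num x r : 0 < r -> mu (qball d x r) \is a fin_num.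
Proof. by move=> /(qball_fin x) /andP[? ?]; rewrite ge0_fin_numE. Qed.

Lemma qmetric_refl x : d x x = 0.
Proof. by case: hd => _ _ h _ _; apply/h. Qed.

Lemma le_qball_measure x y r s : 0 < r -> 0 < s -> qball d x r `<=` qball d y s ->
  (mu (qball d x r) <= mu (qball d y s))%E.
Proof. by move=> r0 s0; apply: le_measure; rewrite inE; exact: qball_measurable. Qed.

Lemma doubling_iter x r n : 0 < r ->
  (mu (qball d x (2 ^+ n * r)) <= (Cmu ^+ n)%:E * mu (qball d x r))%E.
Proof.
case: hmu => C1 _ _ hdb r0; elim: n => [|n IH]; first by rewrite !expr0 mul1r mul1e.
rewrite exprS -mulrA; apply: le_trans (hdb _ _ _) _; first by rewrite mulr_gt0// exprn_gt0.
rewrite exprS EFinM -muleA lee_wpmul2l// lee_fin; lra.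
Qed.

Lemma qball_sub x y r s : 0 < r -> A0 * (d x y + r) <= s ->
  qball d x r `<=` qball d y s.
Proof.
case: hd => A1 d0 _ dC dT r0 rs z; rewrite /qball /= => xz.
apply: lt_le_trans rs; apply: (le_lt_trans (dT y x z)).
by rewrite ltr_pM2l ?(lt_le_trans ltr01)// (dC y x) ltrD2l.
Qed.

Lemma qball_comparison x y r s n : 0 < r -> 0 < s ->
  A0 * (d x y + r) <= 2 ^+ n * s ->
  (mu (qball d x r) <= (Cmu ^+ n)%:E * mu (qball d y s))%E.
Proof.
move=> r0 s0 h; apply: le_trans (doubling_iter y n s0).
apply: le_qball_measure => //; last exact: qball_sub.
by rewrite mulr_gt0// exprn_gt0.
Qed.

Lemma bigcup_qball x r : 0 < r -> \bigcup_n qball d x (n.+1%:R * r) = setT.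
Proof.
move=> r0; apply/seteqP; split=> // y _.
exists (Num.truncn (d x y / r)) => //=; rewrite /qball /=.
by rewrite -ltr_pdivrMr// truncnS_gt.
Qed.

(** Supplies the sigma-finiteness that Tonelli's theorem requires. *)
Lemma homogeneous_sigma_finite : X -> sigma_finite setT mu.
Proof.
move=> x; exists (fun n => qball d x (n.+1%:R * 1)).
  by rewrite bigcup_qball.
move=> n; have n0 : (0 < n.+1%:R * 1 :> R) by rewrite mulr1.
by split; [exact: qball_measurable|have /andP[] := qball_fin x n0].
Qed.

Variable (I : choiceType) (D : dyadic_system I d A0).
Local Notation delta := (dy_delta D).

Lemma dy_A0_ge1 : 1 <= A0. Proof. by case: hd. Qed.

Lemma dy_delta_gt0 : 0 < delta.
Proof. by case/andP: (dy_delta_range D). Qed.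

Lemma dy_delta_lt1 : delta < 1.
Proof.
case/andP: (dy_delta_range D) => _ /le_lt_trans; apply.
have A1 := dy_A0_ge1.
rewrite invf_lt1 ?exprn_gt0//; last by lra.
by rewrite exprn_egt1//; lra.
Qed.

Lemma dy_C0_gt0 : 0 < dy_C0 D.
Proof. by case/andP: (dy_c0C0 D) => c0 /(lt_le_trans c0). Qed.

Lemma cube_fin k a : dy_idx D k a -> (0 < mu (dy_cube D k a) < +oo)%E.
Proof.
move=> ka; have dk : 0 < delta ^ k by rewrite exprz_gt0// dy_delta_gt0.
have A1 := dy_A0_ge1; have /andP[c0 _] := dy_c0C0 D; have C0 := dy_C0_gt0.
have A0gt0 : 0 < A0 by lra.
have r1 : 0 < (3 * A0 ^+ 2)^-1 * dy_c0 D * delta ^ k.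
  by rewrite !mulr_gt0// invr_gt0 mulr_gt0// exprn_gt0.
have r2 : 0 < 2 * A0 * dy_C0 D * delta ^ k by rewrite !mulr_gt0.
have mQ := dy_measurable ka.
have /andP[B0 _] := qball_fin (dy_pt D k a) r1.
have /andP[_ By] := qball_fin (dy_pt D k a) r2.
apply/andP; split.
  apply: (lt_le_trans B0); apply: le_measure; rewrite ?inE//.
    exact: qball_measurable.
  exact: dy_inner.
apply: le_lt_trans By; apply: le_measure; rewrite ?inE//.
  exact: qball_measurable.
exact: dy_outer.
Qed.

(** The cubes of one generation are disjoint, of positive measure, and each lies in some ball around
    a fixed point. Countability makes unions over a generation measurable. *)
Lemma countable_idx k : countable (dy_idx D k).
Proof.
have [[a ka]|noidx] := pselect (exists a, dy_idx D k a); last first.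
  by rewrite (_ : dy_idx D k = set0)//; apply/seteqP; split=> // a ka; case: noidx; exists a.
pose x := dy_pt D k a.
rewrite (_ : dy_idx D k = \bigcup_n [set b | dy_idx D k b /\
    0 < mu (dy_cube D k b `&` qball d x (n.+1%:R * 1))]%E); last first.
  apply/seteqP; split=> b; last by move=> [n _ []].
  move=> kb.
  have dk : 0 < delta ^ k by rewrite exprz_gt0// dy_delta_gt0.
  have A1 := dy_A0_ge1; have C0 := dy_C0_gt0.
  pose r := A0 * (d (dy_pt D k b) x + 2 * A0 * dy_C0 D * delta ^ k).
  exists (Num.truncn r) => //; split => //; rewrite setIidl.
    by have /andP[] := cube_fin kb.
  apply: subset_trans (dy_outer kb) _; apply: qball_sub.
    by rewrite !mulr_gt0//; lra.
  by rewrite mulr1 ltW// truncnS_gt.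
apply: bigcup_countable => // n _; apply: countable_positive_measure.
- by apply: qball_measurable; rewrite mulr1.
- by have := @qball_fin x (n.+1%:R * 1); rewrite mulr1 => /(_ _)/andP[].
- exact: dy_measurable.
- exact: dy_disjoint.
Qed.

(* [P x] is the ball of radius [r / (2 A0)] around the centre of a small dyadic
   cube containing [x]. *)
Lemma measurable_ball_family (r : R) : 0 < r ->
  exists P : X -> set X, measurable [set u : X * X | P u.1 u.2] /\
    forall x, qball d x (r / (4 * A0 ^+ 2)) `<=` P x /\ P x `<=` qball d x r.
Proof.
move=> r0; have A1 := dy_A0_ge1; have A0gt0 : 0 < A0 by lra.
have C0 := dy_C0_gt0.
(* The quasi-triangle inequality is used twice, at the cost of a factor [2 * A0] each time:
   [A0 * (e + e) = r / (2 * A0)], and [A0] times twice that is [r]. The generation chosen next is so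
   fine that each cube lies within [e] of its centre. *)
pose e := r / (4 * A0 ^+ 2).
have e0 : 0 < e by rewrite divr_gt0// mulr_gt0// exprn_gt0.
have er : e = r / (2 * A0) / (2 * A0) by rewrite /e; field; rewrite gt_eqF.
have [n hn] : exists n, delta ^+ n < e / (2 * A0 * dy_C0 D).
  apply: exists_expr_lt; first by rewrite dy_delta_gt0 dy_delta_lt1.
  by rewrite divr_gt0// !mulr_gt0.
pose k : int := n%:Z.
pose B a := qball d (dy_pt D k a) (r / (2 * A0)).
have r'0 : 0 < r / (2 * A0) by rewrite divr_gt0// mulr_gt0.
exists (fun x => [set y | exists2 a, dy_idx D k a & dy_cube D k a x /\ B a y]).
split.
  (* The centre depends only on the cube containing [x], so the graph is a countable union of
     measurable rectangles. *)
  rewrite (_ : mkset _ = \bigcup_(a in dy_idx D k) (dy_cube D k a `*` B a)).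
    apply: countable_bigcup_measurable. exact: countable_idx.
    move=> a ka; apply: measurableX; first exact: dy_measurable.
    exact: qball_measurable.
  by apply/seteqP; split=> [[x y] /= [a ka [? ?]]|[x y] /= [a ka [? ?]]]; exists a.
have small a x : dy_idx D k a -> dy_cube D k a x -> d (dy_pt D k a) x < e.
  move=> ka /(dy_outer ka); rewrite /qball /= => /lt_le_trans; apply.
  by move: hn; rewrite ltr_pdivlMr ?mulr_gt0// mulrC => /ltW; rewrite /k.
have ee : A0 * (2 * e) = r / (2 * A0) by rewrite er; field; rewrite gt_eqF.
have er' : e <= r / (2 * A0).
  rewrite er ler_pdivrMr ?mulr_gt0// ler_peMr ?(ltW r'0)//; lra.
move=> x; split.
  have [a ka Qax] : (\bigcup_(a in dy_idx D k) dy_cube D k a) x by rewrite dy_cover.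
  move=> y xy /=; exists a => //; split=> //; rewrite /B.
  move: y xy; apply: qball_sub => //.
  rewrite -ee ler_pM2l// -/e mulr_natl mulr2n lerD2r ltW//.
  by case: hd => _ _ _ dC _; rewrite dC; exact: small.
move=> y /= [a ka [Qax]]; move: y; apply: qball_sub => //.
have hr : A0 * (r / (2 * A0) + r / (2 * A0)) = r by field; rewrite gt_eqF.
by rewrite -[leRHS]hr ler_pM2l// lerD2r (le_trans _ er')// ltW// small.
Qed.

End geometry.

(** * The kernels *)

(** With [w = nu * u^a], [exp (w/n) >= w/n] gives [exp (- w) <= (n/w)^n]. Here [w >= b / (t^a)^i],
    and [n] is chosen with [(t^a)^n <= k]. The bound [1 <= C] is recorded for [i = 0], where the
    trivial estimate of the exponential by 1 is used without a lower bound on [u]. *)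
Lemma expR_powR_decay {R : realType} (nu a c t k : R) :
  0 < nu -> 0 < a -> 0 < c -> 0 < t < 1 -> 0 < k ->
  exists2 C : R, 1 <= C & forall (i : nat) (u : R), c / t ^+ i <= u ->
    expR (- (nu * u `^ a)) <= C * k ^+ i.
Proof.
move=> nu0 a0 c0 /andP[t0 t1] k0.
have ta0 : 0 < t `^ a by exact: powR_gt0.
have ta1 : 0 < t `^ a < 1.
  rewrite ta0/=; have : (t `^ a < 1 `^ a)%R by rewrite gt0_ltr_powR// nnegrE ltW.
  by rewrite powR1.
have [m hm] := exists_expr_lt ta1 k0.
pose n := m.+1.
have hn : (t `^ a) ^+ n <= k.
  by apply: ltW; apply: le_lt_trans hm; rewrite exprS ler_piMl ?exprn_ge0 ?ltW//; case/andP: ta1.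
have n0 : 0 < n%:R :> R by rewrite ltr0n.
pose b := nu * c `^ a.
have b0 : 0 < b by rewrite mulr_gt0// powR_gt0.
exists (1 + (n%:R / b) ^+ n); first by rewrite lerDl exprn_ge0// divr_ge0 ?ltW.
move=> i u cu.
have ti0 : 0 < t ^+ i by exact: exprn_gt0.
have u0 : 0 < u by apply: lt_le_trans cu; rewrite divr_gt0.
have ua : b / (t `^ a) ^+ i <= nu * u `^ a.
  rewrite /b -mulrA ler_pM2l// -exprn_powR ?(ltW t0)//.
  rewrite ler_pdivrMr ?powR_gt0// -powRM ?(ltW u0) ?(ltW ti0)//.
  by rewrite ge0_ler_powR ?nnegrE ?mulr_ge0 ?(ltW a0) ?(ltW c0) ?(ltW u0) ?(ltW ti0)// -ler_pdivrMr.
set w := nu * u `^ a in ua *.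
have w0 : 0 < w by rewrite mulr_gt0// powR_gt0.
have h1 : expR (- w) <= (n%:R / w) ^+ n.
  have -> : - w = (- (w / n%:R)) * n%:R by rewrite mulNr divfK// gt_eqF.
  rewrite expRM_natr; apply: lerXn2r; rewrite ?nnegrE ?expR_ge0 ?divr_ge0 ?(ltW n0) ?(ltW w0)//.
  rewrite expRN -[leRHS]invrK lef_pV2 ?posrE ?expR_gt0 ?invr_gt0 ?divr_gt0//.
  rewrite invf_div; apply: le_trans (expR_ge1Dx _); lra.
apply: (le_trans h1).
apply: (@le_trans _ _ ((n%:R / b) ^+ n * k ^+ i)); last first.
  by rewrite ler_wpM2r ?exprn_ge0 ?(ltW k0)// lerDr.
apply: (@le_trans _ _ ((n%:R / b) ^+ n * ((t `^ a) ^+ n) ^+ i)); last first.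
  rewrite ler_wpM2l ?exprn_ge0 ?divr_ge0 ?(ltW n0) ?(ltW b0)//.
  by rewrite lerXn2r ?nnegrE ?exprn_ge0 ?powR_ge0 ?(ltW k0).
rewrite -exprM mulnC exprM -exprMn lerXn2r ?nnegrE ?mulr_ge0 ?invr_ge0 ?exprn_ge0 ?powR_ge0 ?(ltW n0) ?(ltW b0) ?(ltW w0)//.
rewrite -mulrA ler_pM2l// -[leRHS]invrK lef_pV2 ?posrE ?invr_gt0 ?mulr_gt0 ?invr_gt0 ?exprn_gt0 ?powR_gt0//.
by rewrite invfM invrK.
Qed.

Lemma exists_expr2_ge {R : realType} (x : R) : exists n, x <= 2 ^+ n.
Proof.
have x1 : 0 < 1 + `|x| by rewrite ltr_pwDl.
have h2 : 0 < (2^-1 : R) < 1 by lra.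
have [n] := exists_expr_lt h2 (etrans (invr_gt0 _) x1).
rewrite exprVn ltf_pV2 ?posrE ?exprn_gt0// => h.
by exists n; apply: le_trans (ler_norm x) _; lra.
Qed.

Section kernel.
Context {R : realType} {disp : measure_display} {X : measurableType disp}.
Variables (d : X -> X -> R) (mu : {measure set X -> \bar R}) (A0 Cmu : R).
Hypothesis hd : quasi_metric d A0.
Hypothesis hmu : homogeneous_type d mu Cmu.
Variables (I : choiceType) (D : dyadic_system I d A0).
Local Notation delta := (dy_delta D).
Variables (Ct : R) (P : int -> X -> set X).
Hypothesis Ct0 : 0 < Ct.
Hypothesis mP : forall j, measurable [set u : X * X | P j u.1 u.2].
Hypothesis hP : forall j x,
  qball d x (Ct * delta ^ j / (4 * A0 ^+ 2)) `<=` P j x /\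
  P j x `<=` qball d x (Ct * delta ^ j).

Lemma expz_delta_gt0 (j : int) : 0 < delta ^ j.
Proof. by rewrite exprz_gt0// dy_delta_gt0. Qed.

Lemma average_set_radius_gt0 (j : int) : 0 < Ct * delta ^ j / (4 * A0 ^+ 2).
Proof.
have A1 := dy_A0_ge1 hd.
by rewrite divr_gt0 ?mulr_gt0 ?exprn_gt0 ?expz_delta_gt0//; lra.
Qed.

Lemma average_set_measurable j x : measurable (P j x).
Proof. exact: measurable_section. Qed.

Lemma average_set_fin j x : (0 < mu (P j x) < +oo)%E.
Proof.
have [h1 h2] := hP j x; have r0 := average_set_radius_gt0 j.
have s0 : 0 < Ct * delta ^ j by rewrite mulr_gt0// expz_delta_gt0.
have mB y r : 0 < r -> measurable (qball d y r) by exact: (qball_measurable hmu).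
apply/andP; split.
  have /andP[B0 _] := qball_fin hmu x r0; apply: (lt_le_trans B0).
  by apply: le_measure; rewrite ?inE//; [exact: mB|exact: average_set_measurable].
have /andP[_ By] := qball_fin hmu x s0; apply: le_lt_trans By.
by apply: le_measure; rewrite ?inE//; [exact: average_set_measurable|exact: mB].
Qed.

Lemma expz_delta_sub (k i : nat) :
  delta ^ (k%:Z - i%:Z) = delta ^+ k / delta ^+ i.
Proof. by rewrite expfzDr ?gt_eqF ?dy_delta_gt0// exprnN. Qed.

(** The radii compared have ratio [Ct * delta^(-i)], so [n0 + n1 * i] doublings suffice, with
    [2^n1 >= delta^-1] and [2^n0] absorbing [2 * A0 * Ct]. Hence the growth in [i] is at most
    geometric, with ratio [L = Cmu^n1]. *)
Lemma average_set_comparison : exists B L : R, [/\ 1 <= B, 1 <= L &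
  forall (k i : nat) (x y : X), d x y <= Ct * delta ^ (k%:Z - i%:Z) ->
    (mu (P (k%:Z - i%:Z) x) <= (B * L ^+ i)%:E * mu (qball d y (delta ^+ k)))%E].
Proof.
have A1 := dy_A0_ge1 hd; have C1 : 1 <= Cmu by case: hmu.
have d0 := dy_delta_gt0 D.
have [n0 hn0] := exists_expr2_ge (2 * A0 * Ct).
have [n1 hn1] := exists_expr2_ge (delta^-1).
exists (Cmu ^+ n0), (Cmu ^+ n1); split; rewrite ?exprn_ege1//.
move=> k i x y dxy; rewrite -exprM -exprD.
have [_ h2] := hP (k%:Z - i%:Z) x.
have s0 : 0 < Ct * delta ^ (k%:Z - i%:Z) by rewrite mulr_gt0// expz_delta_gt0.
apply: (@le_trans _ _ (mu (qball d x (Ct * delta ^ (k%:Z - i%:Z))))).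
  apply: le_measure; rewrite ?inE//; first exact: average_set_measurable.
  exact: (qball_measurable hmu).
apply: (qball_comparison hd hmu) => //; first exact: exprn_gt0.
apply: (@le_trans _ _ (2 * A0 * Ct * delta ^ (k%:Z - i%:Z))).
  rewrite -!mulrA [2 * _]mulrCA ler_pM2l; last by lra.
  by rewrite mulr_natl mulr2n lerD2r.
rewrite expz_delta_sub mulrA mulrAC ler_wpM2r ?exprn_ge0 ?(ltW d0)//.
rewrite exprD -exprVn; apply: ler_pM => //.
- by rewrite !mulr_ge0 ?(ltW Ct0)//; lra.
- by rewrite exprn_ge0// invr_ge0 ltW.
- by rewrite exprM lerXn2r ?nnegrE ?invr_ge0 ?exprn_ge0 ?(ltW d0).
Qed.

Lemma hk_itv (nu a : R) k x y : 0 < nu -> 0 <= hk D nu a k x y <= 1.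
Proof.
move=> nu0; rewrite /hk; set e := (_ `^ a)%E.
have e0 : (0 <= e)%E by exact: poweR_ge0.
(* An infinite exponent, as for empty [Y k], gives the value 0. *)
case: e e0 => [e||] //= e0; last by rewrite gt0_muley ?lte_fin// lexx ler01.
rewrite expR_ge0/= -expR0 ler_expR oppr_le0 mulr_ge0 ?(ltW nu0)//.
Qed.

Lemma ek_ge0 (nu a : R) k x y : 0 <= ek mu D nu a k x y.
Proof. by rewrite mulr_ge0 ?expR_ge0// invr_ge0 sqrtr_ge0. Qed.

Lemma Ek_le_ek (nu a : R) k x y : 0 < nu -> Ek mu D nu a k x y <= ek mu D nu a k x y.
Proof.
move=> nu0; case: k => [|k] //=.
by have /andP[_ h1] := hk_itv a k.+1 x y nu0; rewrite ler_piMr// ek_ge0.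
Qed.

(** Take the least [i] with [d x y < c * delta^(k-i)]; then [y] lies in [P (k-i) x]. Replacing the
    volumes of the balls of radius [delta^k] by that of [P (k-i) x] costs [B * L^i]. For [i > 0],
    minimality gives [d x y / delta^k >= c * delta / delta^i], so the exponential is at most
    [K * (rho/L)^i], which pays for [L^i] and leaves [rho^i]. *)
Lemma ek_le_average (nu a rho : R) : 0 < nu -> 0 < a -> 0 < rho < 1 ->
  exists2 C : R, 0 < C & forall k x y, exists2 i : nat, P (k%:Z - i%:Z) x y &
    ek mu D nu a k x y <= C * rho ^+ i / fine (mu (P (k%:Z - i%:Z) x)).
Proof.
move=> nu0 a0 /andP[rho0 rho1].
have A1 := dy_A0_ge1 hd; have d0 := dy_delta_gt0 D; have d1 := dy_delta_lt1 hd D.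
have [B [L [B1 L1 hBL]]] := average_set_comparison.
have A2 : 1 <= 4 * A0 ^+ 2 by have := @exprn_ege1 R 2 A0 A1; lra.
pose c := Ct / (4 * A0 ^+ 2).
have c0 : 0 < c by rewrite divr_gt0//; lra.
have cCt : c <= Ct by rewrite ler_pdivrMr ?ler_peMr ?(ltW Ct0)//; lra.
have [K K1 hK] := @expR_powR_decay R nu a (c * delta) delta (rho / L) nu0 a0
  (mulr_gt0 c0 d0) (introT andP (conj d0 d1)) (divr_gt0 rho0 (lt_le_trans ltr01 L1)).
exists (B * K); first by rewrite mulr_gt0//; lra.
move=> k x y.
have hex : exists i : nat, d x y < c * delta ^ (k%:Z - i%:Z).
  have dk : 0 < c * delta ^+ k / (1 + d x y).
    have d0' : 0 <= d x y by case: hd.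
    by apply: divr_gt0; [exact/mulr_gt0/exprn_gt0|lra].
  have [i hi] := exists_expr_lt (introT andP (conj d0 d1)) dk.
  exists i; rewrite expz_delta_sub mulrA ltr_pdivlMr ?exprn_gt0//.
  have d0' : 0 <= d x y by case: hd.
  move: hi; rewrite ltr_pdivlMr; last by lra.
  apply: le_lt_trans; rewrite mulrC ler_pM2l ?exprn_gt0//; lra.
pose i := ex_minn hex; exists i.
  rewrite /i; case: ex_minnP => n hn _; have [h1 _] := hP (k%:Z - n%:Z) x.
  by apply: h1; rewrite /qball /= mulrAC.
have [di imin] : d x y < c * delta ^ (k%:Z - i%:Z) /\
    forall n, d x y < c * delta ^ (k%:Z - n%:Z) -> (i <= n)%N.
  by rewrite /i; case: ex_minnP.
have hi : d x y <= Ct * delta ^ (k%:Z - i%:Z).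
  by apply: (le_trans (ltW di)); rewrite ler_pM2r ?expz_delta_gt0.
have d0' : 0 <= Ct * delta ^ (k%:Z - i%:Z) by rewrite mulr_ge0 ?ltW// expz_delta_gt0.
have /andP[P0 Py] := average_set_fin (k%:Z - i%:Z) x.
have Pf : mu (P (k%:Z - i%:Z) x) \is a fin_num by rewrite ge0_fin_numE.
set v := fine (mu (P (k%:Z - i%:Z) x)).
have v0 : 0 < v by rewrite fine_gt0// P0.
pose G := B * L ^+ i.
have G0 : 0 < G by rewrite mulr_gt0 ?exprn_gt0//; lra.
have hV z : d x z <= Ct * delta ^ (k%:Z - i%:Z) -> v / G <= Vr d mu (delta ^+ k) z.
  move=> /hBL; have dk : 0 < delta ^+ k by exact: exprn_gt0.
  rewrite -[X in (X <= _)%E]fineK// -[X in (_ <= _ * X)%E]fineK ?(qball_fin_num hmu)//.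
  by rewrite -EFinM lee_fin ler_pdivrMr// mulrC.
(* Both [x] and [y] are within [Ct * delta^(k-i)] of [x], so both volumes, and hence their geometric
   mean, are at least [v / G]. *)
have hsqrt : v / G <= Num.sqrt (Vr d mu (delta ^+ k) x * Vr d mu (delta ^+ k) y).
  have vG : 0 <= v / G by rewrite divr_ge0 ?ltW.
  rewrite -[leLHS](ger0_norm vG) -sqrtr_sqr ler_sqrt; last first.
    by rewrite mulr_ge0// fine_ge0.
  by rewrite expr2 ler_pM// hV// (qmetric_refl hd).
(* For [i = 0] minimality says nothing, and the exponential is bounded by [1 <= K]. *)
have hexp : expR (- (nu * (d x y / delta ^+ k) `^ a)) <= K * (rho / L) ^+ i.
  have [i0|i0] := posnP i.
    rewrite i0 expr0 mulr1; apply: le_trans K1.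
    by rewrite -expR0 ler_expR oppr_le0 mulr_ge0 ?powR_ge0 ?(ltW nu0).
  apply: hK; rewrite leNgt; apply/negP => h.
  suff : (i <= i.-1)%N by rewrite leqNgt prednK// leqnn.
  apply: imin; rewrite expz_delta_sub; move: h.
  rewrite ltr_pdivrMr ?exprn_gt0// => /lt_le_trans; apply.
  rewrite -[X in _ / delta ^+ X * _](prednK i0) exprS.
  have q0 : 0 < delta ^+ i.-1 by exact: exprn_gt0.
  set q := delta ^+ i.-1 in q0 *; set dk := delta ^+ k.
  by rewrite le_eqVlt; apply/orP; left; apply/eqP; field; rewrite !gt_eqF.
rewrite /ek.
apply: (@le_trans _ _ ((v / G)^-1 * (K * (rho / L) ^+ i))).
  apply: ler_pM => //; rewrite ?invr_ge0 ?sqrtr_ge0 ?expR_ge0//.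
  by rewrite lef_pV2 ?posrE ?divr_gt0// (lt_le_trans _ hsqrt)// divr_gt0.
rewrite invf_div /G exprMn exprVn.
have L0 : L ^+ i != 0 by rewrite expf_neq0// gt_eqF//; lra.
rewrite le_eqVlt; apply/orP; left; apply/eqP; field.
by rewrite L0 gt_eqF.
Qed.

End kernel.

(** * Integration against kernels with geometric decay *)

Section kernel_integrals.
Context {R : realType} {disp : measure_display} {X : measurableType disp}.
Variable mu : {measure set X -> \bar R}.
Local Open Scope ereal_scope.

(** At each point one of the functions [C * t^i / mu (E i)] on [E i] dominates [|q|], hence so does
    their sum, which is integrated term by term. *)
Lemma integral_kernel_le (E : nat -> set X) (q : X -> R) (C t : R)
    (g : X -> \bar R) : (0 <= C)%R -> (0 < t < 1)%R ->
  (forall i, measurable (E i)) ->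
  (forall x, exists2 i, E i x & (`|q x| <= C * t ^+ i / fine (mu (E i)))%R) ->
  measurable_fun setT g -> (forall x, 0 <= g x) ->
  \int[mu]_x (`|q x|%:E * g x) <=
    C%:E * \sum_(i <oo) (t ^+ i)%:E * emean mu (E i) g.
Proof.
move=> C0 /andP[t0 t1] mE qE mg g0.
pose c i : R := (C * t ^+ i / fine (mu (E i)))%R.
have c0 i : (0 <= c i)%R.
  by rewrite divr_ge0 ?mulr_ge0 ?exprn_ge0 ?(ltW t0)// fine_ge0.
have gE0 i x : 0 <= (g \_ (E i)) x by exact: erestrict_ge0.
have mgE i : measurable_fun setT (g \_ (E i)).
  by apply/(measurable_restrictT _ (mE i)); exact: measurable_funTS.
have cg0 i x : 0 <= (c i)%:E * (g \_ (E i)) x by rewrite mule_ge0 ?lee_fin.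
apply: (@le_trans _ _ (\int[mu]_x \sum_(i <oo) (c i)%:E * (g \_ (E i)) x)).
  apply: le_integral_ge0 => x _; rewrite mule_ge0 ?lee_fin//=.
  have [i Eix qi] := qE x.
  apply: (@le_trans _ _ ((c i)%:E * (g \_ (E i)) x)).
    by rewrite /patch mem_set// lee_wpmul2r// lee_fin.
  exact: (@nneseries_ge_term _ (fun i => (c i)%:E * (g \_ (E i)) x)).
rewrite integral_nneseries//; last by move=> i; exact: measurable_funeM.
rewrite -nneseriesZl; last first.
  by move=> i _; rewrite mule_ge0 ?EFin_exp_ge0 ?(ltW t0)// emean_ge0.
apply: lee_nneseries => i _.
  by move=> _; apply: integral_ge0 => x _; exact: cg0.
rewrite ge0_integralZl_EFin// -integral_mkcond /emean !muleA -!EFinM.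
exact: lexx.
Qed.

Lemma integral_norm_kernel_le (E : nat -> set X) (q : X -> R) (C t : R) :
  (0 <= C)%R -> (0 < t < 1)%R ->
  (forall i, measurable (E i)) -> (forall i, 0 < mu (E i) < +oo) ->
  (forall x, exists2 i, E i x & (`|q x| <= C * t ^+ i / fine (mu (E i)))%R) ->
  measurable_fun setT q ->
  \int[mu]_x `|q x|%:E <= (C / (1 - t))%:E.
Proof.
move=> C0 t01 mE Efin qE mq.
have := @integral_kernel_le E q C t (cst 1) C0 t01 mE qE.
under eq_integral do rewrite mule1.
move=> /(_ (measurable_cst _) (fun=> lee01)) /le_trans; apply.
rewrite EFinM lee_wpmul2l ?lee_fin//.
rewrite -[leRHS]mule1; apply: nneseries_geometric_le => // i.
by rewrite (@emean_cst _ _ _ mu (E i) 1)// lexx lee01.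
Qed.

(** Cancellation in the form [f * q = (f - y) * q + y * q]. It is applied with [y] the value of [f]
    at the centre and [b] equal to 0 or 1. *)
Lemma Rintegral_kernel_le (E : nat -> set X) (q f : X -> R) (C t y b : R) :
  (0 <= C)%R -> (0 < t < 1)%R ->
  (forall i, measurable (E i)) -> (forall i, 0 < mu (E i) < +oo) ->
  (forall x, exists2 i, E i x & (`|q x| <= C * t ^+ i / fine (mu (E i)))%R) ->
  measurable_fun setT q -> measurable_fun setT f ->
  (\int[mu]_x q x)%R = b ->
  `|(\int[mu]_x (f x * q x))%R|%:E <=
    C%:E * \sum_(i <oo) (t ^+ i)%:E * emean mu (E i) (fun x => `|y - f x|%:E)
    + `|b * y|%:E.
Proof.
move=> C0 t01 mE Efin qE mq mf qb.
set S := C%:E * _.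
have mg : measurable_fun setT (fun x => `|y - f x|%:E).
  by apply/measurable_EFinP; apply: measurableT_comp => //; exact: measurable_funB.
have iS : \int[mu]_x (`|q x|%:E * `|y - f x|%:E) <= S.
  by apply: integral_kernel_le => // x; rewrite lee_fin.
(* An infinite [S] makes the bound trivial; a finite one gives the integrability of [(f - y) * q]
   that the splitting of the integral requires. *)
have [->|Sy] := eqVneq S +oo; first by rewrite addye ?leey.
have iq : mu.-integrable setT (EFin \o q).
  apply/integrableP; split; first exact/measurable_EFinP.
  apply: le_lt_trans (ltry (C / (1 - t))).
  exact: (integral_norm_kernel_le C0 t01 mE Efin qE mq).
have ifq : mu.-integrable setT (EFin \o (fun x => (f x - y) * q x)%R).
  apply/integrableP; split.
    apply/measurable_EFinP; apply: measurable_funM => //; exact: measurable_funB.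
  apply: le_lt_trans (_ : S < +oo); last by rewrite ltey.
  apply: le_trans iS; rewrite le_eqVlt; apply/orP; left; apply/eqP.
  by apply: eq_integral => x _; rewrite /= -EFinM distrC normrM mulrC.
have iyq : mu.-integrable setT (EFin \o (fun x => y * q x)%R).
  exact: (integrableZl measurableT y iq).
have -> : (\int[mu]_x (f x * q x) =
    \int[mu]_x ((f x - y) * q x) + b * y)%R.
  rewrite -qb mulrC -RintegralZl// -RintegralD//.
  by apply: eq_Rintegral => x _; rewrite -mulrDl subrK.
apply: le_trans (_ : (`|(\int[mu]_x ((f x - y) * q x))%R| + `|b * y|)%:E <= _).
  by rewrite lee_fin ler_normD.
rewrite EFinD leeD2r//; apply: le_trans iS.
apply: le_trans (_ : (\int[mu]_x (`|(f x - y) * q x|))%R%:E <= _).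
  by rewrite lee_fin le_normr_Rintegral.
rewrite /Rintegral fineK; last first.
  by apply: integrable_fin_num => //; exact: integrable_norm.
rewrite le_eqVlt; apply/orP; left; apply/eqP.
by apply: eq_integral => x _; rewrite -EFinM distrC normrM mulrC.
Qed.

(** A function with supremum and integral both at most [c] pairs with all [L^p] at once: for finite
    [p], [|f g| <= |g|] where [|f| <= 1], and [|f g| <= c |f|^p] elsewhere, since [p >= 1]. The
    constant [K] is not homogeneous in [f], which is harmless because [f] is fixed. *)
Lemma Lfun_pairing (p : \bar R) (f : X -> R) : 1 <= p -> f \in Lfun mu p ->
  exists2 K : R, (0 < K)%R & forall (g : X -> R) (c : R), measurable_fun setT g ->
    (forall x, (`|g x| <= c)%R) -> \int[mu]_x `|g x|%:E <= c%:E ->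
    \int[mu]_x `|f x * g x|%:E <= (K * c)%:E.
Proof.
move=> p1 /andP[]; rewrite inE /= => mf; rewrite inE /= /finite_norm => fp.
case: p p1 fp => [p||] // p1 fp; last first.
  (* On a space of measure zero the norm for [p = +oo] is 0 by convention and gives no bound on [f];
     there the integral vanishes. *)
  have [muT0|muT0] := leP (mu setT) 0.
    exists 1%R => // g c mg gc gi; rewrite mul1r.
    have c0 : (0 <= c)%R.
      by rewrite -lee_fin (le_trans _ gi)//; exact: integral_ge0.
    have muE : mu setT = 0 by apply/eqP; rewrite eq_le muT0 measure_ge0.
    have -> : \int[mu]_x `|f x * g x|%:E = 0; last by rewrite lee_fin.
    apply: null_set_integral => //=.
    apply/measurable_EFinP; apply: measurableT_comp => //; exact: measurable_funM.
  move: fp; rewrite unlock muT0 => fp.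
  set M := ess_sup _ _ in fp.
  have M0 : 0 <= M by apply: ess_sup_gee => //; apply: nearW => x; exact: abse_ge0.
  have Mf : M \is a fin_num by rewrite ge0_fin_numE.
  exists (1 + fine M)%R; first by rewrite ltr_pwDl// fine_ge0.
  move=> g c mg gc gi.
  have c0 : (0 <= c)%R by rewrite -lee_fin (le_trans _ gi)//; exact: integral_ge0.
  apply: (@le_trans _ _ (\int[mu]_x ((1 + fine M)%:E * `|g x|%:E))); last first.
    rewrite ge0_integralZl_EFin//.
    - by rewrite EFinM lee_wpmul2l// lee_fin addr_ge0// fine_ge0.
    - by apply/measurable_EFinP; exact: measurableT_comp.
    - by rewrite addr_ge0// fine_ge0.
  apply: ae_ge0_le_integral => //=.
  - apply/measurable_EFinP; apply: measurableT_comp => //; exact: measurable_funM.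
  - by move=> x _; rewrite mule_ge0// lee_fin addr_ge0// fine_ge0.
  - by apply: measurable_funeM; apply/measurable_EFinP; exact: measurableT_comp.
  have := ess_sup_ge mu (abse \o (EFin \o f)).
  apply: filterS => x /=; rewrite -/M -(fineK Mf) lee_fin => fx _.
  rewrite -EFinM lee_fin normrM ler_wpM2r//; lra.
rewrite lee_fin in p1; have p0 : (0 < p)%R by exact: lt_le_trans p1.
have Iy : \int[mu]_x (`|f x| `^ p)%:E < +oo.
  move: fp; rewrite unlock /= => fp.
  by apply: lty_poweRy fp; rewrite invr_neq0// gt_eqF.
have I0 : 0 <= \int[mu]_x (`|f x| `^ p)%:E.
  by apply: integral_ge0 => x _; rewrite lee_fin powR_ge0.
have If : \int[mu]_x (`|f x| `^ p)%:E \is a fin_num by rewrite ge0_fin_numE.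
have mfp : measurable_fun setT (fun x => (`|f x| `^ p)%:E).
  apply/measurable_EFinP; apply: (measurableT_comp (measurable_powR p)).
  exact: measurableT_comp.
exists (1 + fine (\int[mu]_x (`|f x| `^ p)%:E))%R.
  by rewrite ltr_pwDl// fine_ge0.
move=> g c mg gc gi.
have c0 : (0 <= c)%R by rewrite -lee_fin (le_trans _ gi)//; exact: integral_ge0.
apply: (@le_trans _ _ (\int[mu]_x (`|g x|%:E + c%:E * (`|f x| `^ p)%:E))).
  apply: le_integral_ge0 => x _; rewrite lee_fin normr_ge0/= -EFinM -EFinD lee_fin normrM.
  have [f1|f1] := leP `|f x|%R 1%R.
    apply: (@le_trans _ _ `|g x|%R); first by rewrite ler_piMl.
    by rewrite lerDl mulr_ge0// powR_ge0.
  apply: (@le_trans _ _ (c * `|f x| `^ p)%R); last by rewrite lerDr.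
  rewrite mulrC ler_pM// le1r_powR// ltW//.
rewrite ge0_integralD//; last 3 first.
- by apply/measurable_EFinP; exact: measurableT_comp.
- by move=> x _; rewrite mule_ge0// lee_fin powR_ge0.
- exact: measurable_funeM.
rewrite ge0_integralZl_EFin//.
rewrite mulrDl mul1r EFinD leeD// EFinM fineK// muleC//.
Qed.

End kernel_integrals.

(** * Functions in [L^p] as distributions *)

Section distributions_of_functions.
Context {R : realType} {disp : measure_display} {X : measurableType disp}.
Variables (d : X -> X -> R) (mu : {measure set X -> \bar R}) (A0 Cmu : R).
Hypothesis hd : quasi_metric d A0.
Hypothesis hmu : homogeneous_type d mu Cmu.
Variables (x0 : X) (r0 : R).
Hypothesis hr0 : 0 < r0.

(** Annuli around [x0]: if [n > 0] is least with [d x0 x < 2^n * r0], then doubling gives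
    [mu (E n) <= Cmu * Vxy x0 x], and the decay factor is at most [t^(n-1)] with [t = 2^(-gamma)].
    Thus the weight [w] decays geometrically relative to the balls [E n], and is also bounded by
    [1 / V]. *)
Lemma test_bound_integral (beta gamma : R) : 0 < gamma -> exists2 K : R, 0 < K &
  forall (g : X -> R) (C : R), measurable_fun setT g ->
    test_bound d mu A0 x0 r0 beta gamma g C ->
    [/\ 0 <= C, forall x, `|g x| <= C * K &
      (\int[mu]_x `|g x|%:E <= (C * K)%:E)%E].
Proof.
move=> gamma0.
have C1 : 1 <= Cmu by case: hmu.
have d0 x y : 0 <= d x y by case: hd.
pose E n := qball d x0 (2 ^+ n * r0).
have pow2 n : 0 < 2 ^+ n :> R by exact: exprn_gt0.
have r2 n : 0 < 2 ^+ n * r0 by exact: mulr_gt0.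
have mE n : measurable (E n) by exact: (qball_measurable hmu).
have Efin n : (0 < mu (E n) < +oo)%E by exact: (qball_fin hmu).
pose V := Vr d mu r0 x0.
have V0 : 0 < V.
  have /andP[v0 vy] := qball_fin hmu x0 hr0.
  by rewrite fine_gt0// v0.
pose w x := (V + Vxy d mu x0 x)^-1 * (r0 / (r0 + d x0 x)) `^ gamma.
have VV x : 0 < V + Vxy d mu x0 x by rewrite ltr_wpDr// fine_ge0.
have rr x : 0 < r0 / (r0 + d x0 x) by rewrite divr_gt0// ltr_wpDr.
have rr1 x : r0 / (r0 + d x0 x) <= 1.
  by rewrite ler_pdivrMr ?mul1r ?lerDl// ltr_wpDr.
have pow1 x : (r0 / (r0 + d x0 x)) `^ gamma <= 1.
  have : (r0 / (r0 + d x0 x)) `^ gamma <= 1 `^ gamma.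
    by rewrite ge0_ler_powR ?nnegrE ?(ltW gamma0) ?(ltW (rr x)).
  by rewrite powR1.
have w0 x : 0 < w x by rewrite mulr_gt0 ?invr_gt0// powR_gt0.
have wV x : w x <= V^-1.
  rewrite -[leRHS]mulr1 ler_pM ?invr_ge0 ?powR_ge0 ?(ltW (VV x))//.
  by rewrite lef_pV2 ?posrE// lerDl fine_ge0.
pose t : R := 2^-1 `^ gamma.
have t0 : 0 < t by rewrite powR_gt0.
have t1 : t < 1.
  have : 2^-1 `^ gamma < (1 : R) `^ gamma.
    by rewrite gt0_ltr_powR ?nnegrE//; lra.
  by rewrite powR1.
(* [Cmu] pays for doubling from [n - 1] to [n], and [1 / t] for replacing [t^(n-1)] by [t^n]. *)
pose K1 := Cmu / t.
have K10 : 0 < K1 by apply: divr_gt0 => //; lra.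
have wE x : exists2 n, E n x & w x <= K1 * t ^+ n / fine (mu (E n)).
  have hex : exists n, d x0 x < 2 ^+ n * r0.
    have [n hn] := exists_expr2_ge (1 + d x0 x / r0).
    exists n; rewrite -ltr_pdivrMr//; lra.
  case: (ex_minnP hex) => n hn nmin; exists n => //.
  have [n0|n0] := posnP n.
    rewrite n0 expr0 mulr1; apply: (le_trans (wV x)).
    rewrite /E expr0 mul1r -/V -[leLHS]mul1r ler_wpM2r ?invr_ge0 ?(ltW V0)//.
    by rewrite ler_pdivlMr//; lra.
  have dn : 2 ^+ n.-1 * r0 <= d x0 x.
    rewrite leNgt; apply/negP => /nmin; by rewrite leqNgt prednK// leqnn.
  have dpos : 0 < d x0 x by apply: lt_le_trans dn; exact: mulr_gt0.
  have En0 : 0 < fine (mu (E n)).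
    by have /andP[v0 vy] := Efin n; rewrite fine_gt0// v0.
  have h1 : fine (mu (E n)) <= Cmu * Vxy d mu x0 x.
    rewrite -lee_fin EFinM /Vxy !fineK ?(qball_fin_num hmu)//.
    have -> : E n = qball d x0 (2 * (2 ^+ n.-1 * r0)).
      by rewrite mulrA -exprS prednK.
    case: hmu => _ _ _ /(_ x0 (2 ^+ n.-1 * r0) (mulr_gt0 (pow2 _) hr0)) /le_trans; apply.
    apply: lee_wpmul2l; first by rewrite lee_fin; lra.
    apply: (le_qball_measure hmu) => //.
    by move=> y; rewrite /qball /= => /lt_le_trans; apply.
  have h2 : (r0 / (r0 + d x0 x)) `^ gamma <= t ^+ n / t.
    have -> : t ^+ n / t = t ^+ n.-1.
      by rewrite -{1}(prednK n0) exprS mulrAC divff ?mul1r// gt_eqF.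
    rewrite /t -exprn_powR ?invr_ge0// ge0_ler_powR ?nnegrE ?exprn_ge0 ?invr_ge0 ?(ltW gamma0) ?(ltW (rr x))//.
    rewrite exprVn ler_pdivrMr ?ltr_wpDr// mulrC ler_pdivlMr//.
    by rewrite mulrC; apply: (le_trans dn); rewrite lerDr ltW.
  rewrite /w /K1; apply: (@le_trans _ _ ((Cmu / fine (mu (E n))) * (t ^+ n / t))).
    apply: ler_pM => //; rewrite ?invr_ge0 ?powR_ge0 ?(ltW (VV x))//.
    rewrite ler_pdivlMr// mulrC ler_pdivrMr//; apply: (le_trans h1).
    by rewrite ler_pM2l ?lerDr ?(ltW V0)//; lra.
  rewrite le_eqVlt; apply/orP; left; apply/eqP; field.
  by rewrite !gt_eqF.
pose K := V^-1 + K1 / (1 - t).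
have K0 : 0 < K.
  rewrite addr_gt0 ?invr_gt0// divr_gt0//; lra.
exists K => // g C mg [hg _].
have gw x : `|g x| <= C * w x by rewrite mulrA; exact: hg.
(* The sign of [C] is not part of [test_bound]; it follows from the bound at [x0], where the weight
   is positive. *)
have Cge0 : 0 <= C by rewrite -(pmulr_lge0 _ (w0 x0)) (le_trans _ (gw x0)).
split=> //.
- move=> x; apply: (le_trans (gw x)); rewrite ler_wpM2l// (le_trans (wV x))//.
  by rewrite lerDl divr_ge0 ?(ltW K10)//; lra.
apply: (@le_trans _ _ (C * K1 / (1 - t))%:E); last first.
  rewrite lee_fin -mulrA ler_wpM2l// lerDr invr_ge0 ltW//.
apply: (@integral_norm_kernel_le _ _ _ mu E) => //; first by rewrite mulr_ge0// ltW.
  by rewrite t0.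
move=> x; have [n En wn] := wE x; exists n => //.
by apply: (le_trans (gw x)); rewrite -!mulrA ler_wpM2l// !mulrA.
Qed.

Lemma Lfun_distribution (eta beta gamma : R) (p : \bar R) (f : X -> R) :
  0 < gamma -> (1 <= p)%E -> f \in Lfun mu p ->
  Defs.distribution d mu A0 x0 r0 eta beta gamma (distr_of_fun mu f).
Proof.
move=> gamma0 p1 fp.
have mf : measurable_fun setT f by case/andP: fp; rewrite inE.
have [K K0 hK] := Lfun_pairing p1 fp.
have [K' K'0 hK'] := test_bound_integral beta gamma0.
have key g C : measurable_fun setT g -> test_bound d mu A0 x0 r0 beta gamma g C ->
    (\int[mu]_x `|f x * g x|%:E <= (K * (C * K'))%:E)%E.
  by move=> mg /(hK' _ _ mg)[C0 h1 h2]; exact: hK.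
have int g : test_fun d mu A0 x0 r0 beta gamma g ->
    mu.-integrable setT (EFin \o (fun x => f x * g x)).
  move=> [mg [C gC]]; apply/integrableP; split.
    by apply/measurable_EFinP; exact: measurable_funM.
  exact: le_lt_trans (key g C mg gC) (ltry _).
split.
  move=> c g h [tg _] [th _]; rewrite /distr_of_fun.
  have ig := int g tg; have ih := int h th.
  rewrite -RintegralZl// -RintegralD//; last exact: (integrableZl measurableT c ig).
  by apply: eq_Rintegral => x _; rewrite mulrDr mulrCA.
exists (K * K') => g [[mg [C gC]] _]; rewrite mulrC -ler_pdivrMr ?mulr_gt0//.
(* The estimate holds with every admissible constant, hence with their infimum [test_norm]. *)
apply: lb_le_inf; first by exists C.
move=> B gB; rewrite /= ler_pdivrMr ?mulr_gt0// mulrCA.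
have ig := int g (conj mg (ex_intro _ C gC)).
apply: (le_trans (le_normr_Rintegral measurableT ig)).
rewrite -lee_fin /Rintegral fineK; last first.
  by apply: integrable_fin_num => //; exact: integrable_norm.
exact: key.
Qed.

End distributions_of_functions.

(** * The embeddings *)

(** The same set function is repackaged with a richer structure. Destructing [mu] makes the two
    measures convertible, so the equality can be substituted in the theorem. *)
Lemma exists_sigma_finite_measure {R : realType} {disp : measure_display}
    {X : measurableType disp} (mu : {measure set X -> \bar R}) :
  sigma_finite setT mu ->
  exists nu : {sigma_finite_measure set X -> \bar R},
    (nu : {measure set X -> \bar R}) = mu.
Proof.
case: mu => m [c1 c2] sf.
pose mu : {measure set X -> \bar R} :=
  @Measure.Pack _ _ _ m (@Measure.Class _ _ _ m c1 c2).
pose ax1 := @isSFinite.Axioms_ _ _ _ m (@sfinite_measure_sigma_finite _ X R mu sf).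
pose ax2 := @isSigmaFinite.Axioms_ _ _ _ m sf.
exists (@SigmaFiniteMeasure.Pack _ _ _ m
  (@SigmaFiniteMeasure.Class _ _ _ m c1 c2 ax1 ax2)).
reflexivity.
Qed.

(** * Sums of integrals over disjoint sets *)

Section sums_over_cubes.
Context {R : realType} {disp : measure_display} {X : measurableType disp}.
Variable mu : {measure set X -> \bar R}.
Local Open Scope ereal_scope.

Lemma sum_integral_le (J : choiceType) (r : seq J) (F : J -> set X) (E : set X)
    (g : X -> \bar R) : uniq r ->
  (forall j, j \in r -> measurable (F j)) -> trivIset [set` r] F ->
  (forall j, j \in r -> F j `<=` E) ->
  measurable_fun setT g -> (forall x, 0 <= g x) ->
  \sum_(j <- r) \int[mu]_(x in F j) g x <= \int[mu]_(x in E) g x.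
Proof.
(* Extending [F] by the empty set makes it measurable at every index, as additivity of the integral
   requires. *)
move=> ur mF tF FE mg g0; pose F' j := if j \in r then F j else set0.
have mF' j : measurable (F' j) by rewrite /F'; case: ifPn => // /mF.
have tF' : trivIset [set` r] F'.
  by move=> i j ir jr; rewrite /F' ir jr; exact: tF.
rewrite big_seq (eq_bigr (fun j => \int[mu]_(x in F' j) g x)); last first.
  by move=> j jr; rewrite /F' jr.
rewrite -big_seq -ge0_integral_bigsetU//; last exact: measurable_funTS.
rewrite [leLHS]integral_mkcond [leRHS]integral_mkcond.
apply: le_integral_ge0 => x _; rewrite erestrict_ge0//= /patch.
case: ifPn => [|_]; last by case: ifPn.
rewrite inE -bigcup_seq => -[j /= jr]; rewrite /F' jr => /(FE _ jr) Ex.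
by rewrite mem_set.
Qed.

Lemma esum_integral_le (J : choiceType) (K : set J) (F : J -> set X)
    (g : X -> \bar R) :
  (forall j, K j -> measurable (F j)) -> trivIset K F ->
  measurable_fun setT g -> (forall x, 0 <= g x) ->
  \esum_(j in K) \int[mu]_(x in F j) g x <= \int[mu]_x g x.
Proof.
move=> mF tF mg g0; apply: ge_ereal_sup => _ [G [finG GK] <-].
rewrite fsbig_finite//=; apply: sum_integral_le => //.
- by move=> j; rewrite in_fset_set// inE => /GK; exact: mF.
- move=> i j /=; rewrite !in_fset_set// !inE => /GK Ki /GK Kj.
  exact: tF.
Qed.

Lemma emean_ae_le (E : set X) (g : X -> \bar R) (M : \bar R) : measurable E ->
  0 < mu E < +oo -> measurable_fun setT g -> (forall x, 0 <= g x) ->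
  (\forall x \ae mu, g x <= M) -> 0 <= M -> emean mu E g <= M.
Proof.
move=> mE Ef mg g0 gM M0; rewrite -[leRHS](emean_cst M mE Ef).
rewrite lee_wpmul2l ?lee_fin ?invr_ge0 ?fine_ge0//.
apply: ae_ge0_le_integral => //; first exact: measurable_funTS.
by apply: filterS gM => x.
Qed.

(** Jensen's inequality for the measurable majorant [g]; the factor [mu E] cancels the normalization
    of the mean. *)
Lemma mule_emean_poweR (E : set X) (f g : X -> \bar R) (p : R) : measurable E ->
  0 < mu E < +oo -> measurable_fun setT g -> (forall x, 0 <= f x <= g x) ->
  (1 <= p)%R ->
  mu E * emean mu E f `^ p <= (2 `^ p)%:E * \int[mu]_(x in E) (g x `^ p).
Proof.
move=> mE /[dup] Ef /andP[E0 Ey] mg fg p1.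
have p0 : (0 <= p)%R by exact: le_trans p1.
have g0 x : 0 <= g x by have /andP[f0] := fg x; exact: le_trans.
have Efn : mu E \is a fin_num by rewrite ge0_fin_numE.
apply: (@le_trans _ _ (mu E * ((2 `^ p)%:E * emean mu E (fun x => g x `^ p)))).
  rewrite lee_wpmul2l//; apply: le_trans (emean_poweR mE Ef (measurable_funTS mg) g0 p1).
  apply: le_poweR => //; first by apply: emean_ge0 => x _; have /andP[] := fg x.
  by apply: le_emean => x _; exact: fg.
rewrite muleCA lee_wpmul2l ?lee_fin ?powR_ge0// /emean muleA.
rewrite -[X in X * _ * _]fineK// -EFinM divff ?mul1e//.
by rewrite gt_eqF// fine_gt0// E0.
Qed.

Lemma measurable_lq (q : \bar R) (h : nat -> X -> \bar R) : 0 < q ->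
  (forall j, measurable_fun setT (h j)) ->
  measurable_fun setT (fun x => lq [set: nat] q (h ^~ x)).
Proof.
case: q => [q||] //.
  move=> _ mh /=; apply: (measurableT_comp (measurable_poweR _)).
  rewrite (_ : (fun x => _) = (fun x => \sum_(k <oo) h k x `^ q)); last first.
    by apply/funext => x; rewrite nneseries_esumT// => k; exact: poweR_ge0.
  apply: ge0_emeasurable_sum => [j x _ _|j _]; first exact: poweR_ge0.
  exact: (measurableT_comp (measurable_poweR _)).
move=> _ mh; have := measurable_fun_esups mh 0%N; congr measurable_fun.
apply/funext => x; rewrite /esups /sdrop /=; congr ereal_sup.
by apply/seteqP; split=> _ [j _ <-]; exists j.
Qed.

End sums_over_cubes.

(** * Low-frequency terms *)

Section low_frequency.
Context {R : realType} {disp : measure_display} {X : measurableType disp}.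
Variables (d : X -> X -> R) (mu : {measure set X -> \bar R}) (A0 Cmu : R).
Hypothesis hd : quasi_metric d A0.
Hypothesis hmu : homogeneous_type d mu Cmu.
Variables (I : choiceType) (D : dyadic_system I d A0).
Variables (Q : nat -> X -> X -> R) (T : (X -> R) -> R) (N : nat).
Local Open Scope ereal_scope.

Lemma subcube_prop k a m : subcube_index D k a m ->
  [/\ dy_idx D (k%:Z + (dy_j0 D)%:Z)%R (dy_enum D k%:Z a m),
      measurable (subcube D k a m), 0 < mu (subcube D k a m) < +oo &
      subcube D k a m `<=` dy_cube D k%:Z a].
Proof.
move=> [ka km]; have [h _ _] := dy_enumP ka.
have [ia sub] := h _ km.
split => //; first exact: dy_measurable.
exact: (cube_fin hd hmu).
Qed.

Variable Phi : nat -> X -> \bar R.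
Hypothesis mPhi : forall k, measurable_fun setT (Phi k).
Hypothesis QPhi : forall k x, `|Qapp Q k T x|%:E <= Phi k x.

Let Phi0 k x : 0 <= Phi k x.
Proof. by apply: le_trans (QPhi k x); rewrite lee_fin. Qed.

Lemma sup_absmean_lty :
  (forall k, 'N[mu]_(+oo) [Phi k] < +oo) -> sup_absmean mu D Q N T < +oo.
Proof.
move=> PhiN.
apply: (@le_lt_trans _ _ (\sum_(0 <= k < N.+1) 'N[mu]_(+oo) [Phi k])); last first.
  by apply: lte_sum_pinfty => k _; exact: PhiN.
apply: ge_ereal_sup => _ [k [a [m [kN kam ->]]]].
have [_ mQ Qfin _] := subcube_prop kam.
apply: (@le_trans _ _ ('N[mu]_(+oo) [Phi k])).
  apply: (@le_trans _ _ (emean mu (subcube D k a m) (Phi k))).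
    by apply: le_emean => x _; rewrite lee_fin normr_ge0 QPhi.
  (* Excludes the conventional value 0 of the norm for [p = +oo] on a null space. *)
  have muT : 0 < mu setT.
    have /andP[Q0 _] := Qfin; apply: (lt_le_trans Q0).
    by apply: le_measure; rewrite ?inE.
  apply: emean_ae_le => //; last exact: Lnorm_ge0.
  rewrite unlock muT; have := ess_sup_ge mu (abse \o Phi k).
  by apply: filterS => x; rewrite /= gee0_abs.
rewrite [leRHS](bigD1_seq k) ?iota_uniq ?mem_index_iota//=.
by apply: leeDl; apply: sume_ge0 => i _; exact: Lnorm_ge0.
Qed.

(** After Jensen's inequality on each subcube, disjointness inside a cube and then among the cubes
    of a generation bounds the sum by the integral of [Phi k ^ p]. *)
Lemma low_freq_lty (p : \bar R) : 1 <= p ->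
  (forall k, 'N[mu]_p [Phi k] < +oo) -> low_freq mu D Q N p T < +oo.
Proof.
case: p => [p||] // p1 PhiN; last exact: sup_absmean_lty.
rewrite lee_fin in p1; have p0 : (0 < p)%R by exact: lt_le_trans p1.
rewrite /low_freq; apply: poweR_lty; apply: lte_sum_pinfty => k _.
have mPhip : measurable_fun setT (fun x => Phi k x `^ p).
  exact: (measurableT_comp (measurable_poweR _)).
have Phip0 x : 0 <= Phi k x `^ p by exact: poweR_ge0.
apply: (@le_lt_trans _ _ (\esum_(a in dy_idx D k%:Z)
    ((2 `^ p)%:E * \int[mu]_(x in dy_cube D k%:Z a) (Phi k x `^ p)))).
  apply: le_esum => a ka.
  apply: (@le_trans _ _ (\sum_(1 <= m < (dy_num D k%:Z a).+1)
      (2 `^ p)%:E * \int[mu]_(x in subcube D k a m) (Phi k x `^ p))).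
    rewrite big_seq [leRHS]big_seq; apply: lee_sum => m.
    rewrite mem_index_iota ltnS => km.
    have [_ mQ Qfin _] := subcube_prop (conj ka km).
    by apply: mule_emean_poweR => // x; rewrite lee_fin normr_ge0 QPhi.
  rewrite -ge0_sume_distrr; last by move=> m _; exact: integral_ge0.
  rewrite lee_wpmul2l ?lee_fin ?powR_ge0//.
  apply: sum_integral_le => //; rewrite ?iota_uniq//.
  - move=> m; rewrite mem_index_iota ltnS => km.
    by have [] := subcube_prop (conj ka km).
  (* Subcubes that meet have the same index in their generation, and the enumeration is
     injective. *)
  - have [_ finj _] := dy_enumP ka.
    move=> m n /=; rewrite !mem_index_iota !ltnS => km kn mn.
    have [im _ _ _] := subcube_prop (conj ka km).
    have [jn _ _ _] := subcube_prop (conj ka kn).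
    apply: finj; rewrite ?inE//.
    exact: (dy_disjoint im jn).
  - move=> m; rewrite mem_index_iota ltnS => km.
    by have [] := subcube_prop (conj ka km).
rewrite esumZl ?powR_ge0//; last by move=> a; exact: integral_ge0.
apply: (@le_lt_trans _ _ ((2 `^ p)%:E * \int[mu]_x (Phi k x `^ p))).
  rewrite lee_wpmul2l ?lee_fin ?powR_ge0//; apply: esum_integral_le => //.
    exact: dy_measurable.
  exact: dy_disjoint.
rewrite lte_mul_pinfty ?lee_fin ?powR_ge0//.
have := PhiN k; rewrite unlock => /lty_poweRy.
rewrite invr_neq0 ?gt_eqF// => /(_ isT); congr (_ < _).
by apply: eq_integral => x _; rewrite gee0_abs.
Qed.

End low_frequency.

(** * From Lipschitz norms to Besov and Triebel-Lizorkin norms *)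

Section lipschitz_embeddings.
Context {R : realType} {disp : measure_display} {X : measurableType disp}.
Variables (d : X -> X -> R) (mu : {sigma_finite_measure set X -> \bar R}).
Variables (A0 Cmu : R).
Hypothesis hd : quasi_metric d A0.
Hypothesis hmu : homogeneous_type d mu Cmu.
Variables (I : choiceType) (D : dyadic_system I d A0).
Local Notation delta := (dy_delta D).
Variables (Ct : R) (P : int -> X -> set X).
Hypothesis Ct0 : 0 < Ct.
Hypothesis mP : forall j, measurable [set u : X * X | P j u.1 u.2].
Hypothesis hP : forall j x,
  qball d x (Ct * delta ^ j / (4 * A0 ^+ 2)) `<=` P j x /\
  P j x `<=` qball d x (Ct * delta ^ j).
Variables (eta : R) (Q : nat -> X -> X -> R).
Hypothesis hQ : exp_IATI mu D eta Q.
Local Open Scope ereal_scope.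

Let Pfin j x : 0 < mu (P j x) < +oo.
Proof. exact: (average_set_fin hd hmu Ct0 mP hP). Qed.

Let mPx j x : measurable (P j x).
Proof. exact: measurable_section. Qed.

Let r0 j : (0 < Ct * delta ^ j)%R.
Proof. by rewrite mulr_gt0// expz_delta_gt0. Qed.

Let r0' j : (0 < Ct * delta ^ j / (4 * A0 ^+ 2))%R.
Proof. exact: (average_set_radius_gt0 hd D Ct0). Qed.

(** The case [x = y] compares [mosc] with [osc]; the case [P j x y] provides the set [S] around [y]
    required by [Lnorm_mosc_le]. *)
Lemma qball_le_average : exists2 C : R, (0 < C)%R & forall j x y,
  P j x y \/ x = y ->
  mu (qball d y (Ct * delta ^ j)) <= C%:E * mu (P j x).
Proof.
have A1 := dy_A0_ge1 hd; have C1 : (1 <= Cmu)%R by case: hmu.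
(* [2 * A0] encloses the ball around [y] in one around [x]; [4 * A0 ^+ 2] is the ratio to the radius
   of the ball inside [P j x]. *)
have [n hn] := exists_expr2_ge (2 * A0 * (4 * A0 ^+ 2)).
exists (Cmu ^+ n)%R; first by rewrite exprn_gt0//; lra.
move=> j x y Pxy; have [h1 h2] := hP j x.
have dyx : (d y x <= Ct * delta ^ j)%R.
  case: Pxy => [/h2|->]; last by rewrite (qmetric_refl hd) ltW.
  by case: hd => _ _ _ dC _; rewrite /qball /= dC => /ltW.
apply: (@le_trans _ _ ((Cmu ^+ n)%:E * mu (qball d x (Ct * delta ^ j / (4 * A0 ^+ 2))))).
  apply: (qball_comparison hd hmu) => //.
  apply: (@le_trans _ _ (2 * A0 * (Ct * delta ^ j))%R).
    by rewrite -mulrA [(2 * _)%R]mulrCA ler_pM2l ?mulr_natl ?mulr2n ?lerD2r//; lra.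
  rewrite [leRHS]mulrA ler_pdivlMr; last by rewrite mulr_gt0// exprn_gt0//; lra.
  by rewrite mulrAC; apply: ler_wpM2r => //; exact: ltW.
apply: lee_wpmul2l; first by rewrite lee_fin exprn_ge0//; lra.
by apply: le_measure; rewrite ?inE//; exact: (qball_measurable hmu).
Qed.

Lemma mosc_le_osc : exists2 C : R, (0 < C)%R & forall j f x,
  mosc mu (P j) f x <= C%:E * osc mu D Ct j f x.
Proof.
have [C C0 hC] := qball_le_average; exists C => // j f x.
have [_ h2] := hP j x.
rewrite /mosc /osc /emean muleA -EFinM.
have /andP[P0 Py] := Pfin j x.
have Pf : mu (P j x) \is a fin_num by rewrite ge0_fin_numE.
have Bf := qball_fin_num hmu x (r0 j).
have /andP[B0 _] := qball_fin hmu x (r0 j).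
apply: (@le_trans _ _ (((fine (mu (P j x)))^-1)%:E *
    \int[mu]_(y in qball d x (Ct * delta ^ j)) `|f x - f y|%:E)).
  rewrite lee_wpmul2l ?lee_fin ?invr_ge0 ?fine_ge0//.
  rewrite [leLHS]integral_mkcond [leRHS]integral_mkcond.
  apply: le_integral_ge0 => y _; rewrite erestrict_ge0//= /patch.
  case: ifPn => [|_]; first by rewrite inE => /h2 By; rewrite mem_set.
  by case: ifPn => // _; change (0 <= `|f x - f y|%:E); rewrite lee_fin.
apply: lee_wpmul2r; first by apply: integral_ge0 => y _; rewrite lee_fin.
rewrite lee_fin ler_pdivlMr; last by rewrite fine_gt0// B0 ltey_eq Bf.
rewrite mulrC ler_pdivrMr; last by rewrite fine_gt0// P0.
by rewrite -lee_fin EFinM !fineK//; apply: hC; right.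
Qed.

Lemma Lnorm_mosc : exists2 M : R, (0 < M)%R & forall p j f, 1 <= p ->
  measurable_fun setT f ->
  'N[mu]_p[mosc mu (P j) f] <= M%:E * 'N[mu]_p[EFin \o f].
Proof.
have [C C0 hC] := qball_le_average.
exists (16 * (1 + C))%R; first by lra.
move=> p j f p1 mf; apply: Lnorm_mosc_le => //; first exact: ltW.
move=> y; exists (qball d y (Ct * delta ^ j)); split.
- exact: (qball_measurable hmu).
- exact: (qball_fin hmu).
- move=> x Pxy; split; last by apply: hC; left.
  have [_ /(_ y Pxy)] := hP j x; rewrite /qball /=.
  by case: hd => _ _ _ dC _; rewrite dC.
Qed.

Lemma Qapp_le (rho : R) : (0 < rho < 1)%R -> exists2 K : R, (0 < K)%R &
  forall f, measurable_fun setT f -> forall (k : nat) x,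
  `|Qapp Q k (distr_of_fun mu f) x|%:E <=
    K%:E * \sum_(i <oo) (rho ^+ i)%:E * mosc mu (P (k%:Z - i%:Z)%R) f x
    + `|(k == 0%N)%:R * f x|%:E.
Proof.
move=> rho01.
have [hL2 [_ [C [nu [a [C0 nu0 /andP[a0 _] hk]]]]]] := hQ.
have [K K0 hK] := ek_le_average hd hmu Ct0 mP hP nu0 a0 rho01.
exists (C * K)%R; first exact: mulr_gt0.
move=> f mf k x; have [h1 _ _ h4 _] := hk k.
apply: (@Rintegral_kernel_le _ _ _ mu (fun i => P (k%:Z - i%:Z)%R x)) => //.
- by rewrite mulr_ge0 ?ltW.
- by move=> i; exact: Pfin.
- move=> y; have [i Pi hi] := hK k x y; exists i => //.
  apply: (le_trans (h1 x y)); rewrite -!mulrA ler_pM2l//.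
  by rewrite mulrA; apply: le_trans hi; exact: Ek_le_ek.
- have [mQ _] := hL2 k.
  exact: (measurableT_comp mQ (measurable_pair1 x)).
Qed.

Variables (s : R) (f : X -> R).
Hypothesis s0 : (0 < s)%R.
Hypothesis mf : measurable_fun setT f.

Local Notation T := (distr_of_fun mu f).
Local Notation U := (fun j => mosc mu (P j) f).

Let b (j : int) (x : X) : \bar R := (delta `^ (- (j%:~R * s)))%:E * U j x.

Let U0 j x : 0 <= U j x. Proof. exact: mosc_ge0. Qed.

Let mU j : measurable_fun setT (U j).
Proof. exact: measurable_mosc. Qed.

Let b0 j x : 0 <= b j x.
Proof. by rewrite mule_ge0// lee_fin powR_ge0. Qed.

Let mb j : measurable_fun setT (b j).
Proof. exact: measurable_funeM. Qed.

Let half01 : (0 < (2^-1 : R) < 1)%R.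
Proof. by apply/andP; split; lra. Qed.

Let deltas01 : (0 < delta `^ s < 1)%R.
Proof.
rewrite powR_gt0 ?dy_delta_gt0//=.
have : (delta `^ s < 1 `^ s)%R.
  by rewrite gt0_ltr_powR// ?nnegrE ?(ltW (dy_delta_gt0 D)) ?dy_delta_lt1.
by rewrite powR1.
Qed.

Lemma scaled_Qapp_le : exists2 K : R, (0 < K)%R & forall (k : nat) x, (0 < k)%N ->
  (delta `^ (- (k%:R * s)))%:E * `|Qapp Q k T x|%:E <=
    K%:E * \sum_(i <oo) (2^-1 ^+ i)%:E * b (k%:Z - i%:Z)%R x.
Proof.
have /andP[ds0 ds1] := deltas01; have dgt0 := dy_delta_gt0 D.
have rho01 : (0 < delta `^ s / 2 < 1)%R by apply/andP; split; lra.
have [K K0 hK] := Qapp_le rho01; exists K => // k x k0.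
have := hK f mf k x; rewrite gtn_eqF// mul0r normr0 adde0 => h.
apply: (@le_trans _ _ ((delta `^ (- (k%:R * s)))%:E * (K%:E *
    \sum_(i <oo) ((delta `^ s / 2) ^+ i)%:E * U (k%:Z - i%:Z)%R x))).
  by rewrite lee_wpmul2l// lee_fin powR_ge0.
rewrite muleCA lee_wpmul2l ?lee_fin ?(ltW K0)// -nneseriesZl; last first.
  by move=> i _; rewrite mule_ge0// EFin_exp_ge0//; case/andP: rho01 => /ltW.
rewrite le_eqVlt; apply/orP; left; apply/eqP; apply: eq_eseriesr => i _.
rewrite /b [LHS]muleA [RHS]muleA -!EFinM; congr (_%:E * _).
(* [delta^(-ks) * delta^(is) = delta^(-(k-i)s)]: the weight passes to the scale of [U (k-i)], and
   [2^(-i)] remains. *)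
rewrite exprMn exprVn mulrA mulrC; congr (_ * _)%R.
rewrite -exprn_powR ?(ltW dgt0)// -powR_mulrn ?(ltW dgt0)// -powRrM -powRD; last first.
  by rewrite (gt_eqF dgt0) implybT.
by congr (_ `^ _)%R; rewrite intrB mulrBl opprB addrC.
Qed.

(* [h 0] carries the scales [j >= 0]; the scales [j < 0], where [U j] is only
   controlled by [f], come with the geometric factor [delta^(|j| s)]. *)
Let h (q : \bar R) (i : nat) (x : X) : \bar R :=
  if i is m.+1 then U (Negz m) x else lq [set: nat] q (fun j => b j%:Z x).

Let h0 q i x : 0 <= h q i x.
Proof. by case: i => [|i] //=; apply: lq_ge0 => //; exists 0%N. Qed.

Lemma lq_Qapp_le (q : \bar R) (N : nat) : 0 < q ->
  exists C t : R, [/\ (0 < C)%R, (0 < t < 1)%R & forall x,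
  lq [set k | (N < k)%N] q
    (fun k => (delta `^ (- (k%:R * s)) * `|Qapp Q k T x|)%:E)
  <= C%:E * \sum_(i <oo) (t ^+ i)%:E * h q i x].
Proof.
move=> q0; have [K K0 hK] := scaled_Qapp_le.
have [C1 C10 hC1] := lq_convolution q0 half01.
have [C2 [t [C20 t01 hC2]]] := lq_int_le q0 deltas01.
exists (K * (C1 * C2))%R, t; split=> //; first by rewrite !mulr_gt0.
move=> x; apply: (@le_trans _ _ (lq [set k | (N < k)%N] q (fun k =>
    K%:E * \sum_(i <oo) (2^-1 ^+ i)%:E * b (k%:Z - i%:Z)%R x))).
  apply: le_lq => // k /= Nk; rewrite lee_fin mulr_ge0 ?powR_ge0//= EFinM.
  by apply: hK; exact: leq_ltn_trans Nk.
rewrite lqZl ?(ltW K0)//; last 2 first.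
- move=> k; apply: nneseries_ge0 => i _ _.
  by rewrite mule_ge0// EFin_exp_ge0// ltW//; case/andP: half01.
- by exists N.+1 => /=.
rewrite EFinM -muleA lee_wpmul2l ?lee_fin ?(ltW K0)//.
apply: (le_trans (hC1 N (b ^~ x) (b0 ^~ x))).
rewrite EFinM -muleA lee_wpmul2l ?lee_fin ?(ltW C10)//.
apply: (hC2 (b ^~ x) (h q ^~ x)) => //.
(* As [Negz m = -(m + 1)], the weight of this scale is exactly [(delta^s)^(m+1)]. *)
move=> m; rewrite /b /h le_eqVlt; apply/orP; left; apply/eqP; congr (_%:E * _).
rewrite -exprn_powR ?(ltW (dy_delta_gt0 D))// -powR_mulrn ?(ltW (dy_delta_gt0 D))//.
by rewrite -powRrM NegzE mulrNz mulNr opprK.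
Qed.

(** For a single [k] no smoothness is required: all oscillations have norm at most a constant times
    that of [f]. Term 0 of the series holds [|f|], left over from the total mass 1 of [Q 0], and
    term [i + 1] holds [U (k-i)]. *)
Lemma low_frequency_majorant (p : \bar R) : 1 <= p -> f \in Lfun mu p ->
  exists Phi : nat -> X -> \bar R, [/\ forall k, measurable_fun setT (Phi k),
    forall k x, `|Qapp Q k T x|%:E <= Phi k x &
    forall k, 'N[mu]_p [Phi k] < +oo].
Proof.
move=> p1 fp; have p0 : 0 < p by exact: lt_le_trans p1.
have [K K0 hK] := Qapp_le half01.
have [M M0 hM] := Lnorm_mosc.
have th0 (v : X -> \bar R) i x : 0 <= v x -> 0 <= ((2^-1 : R) ^+ i)%:E * v x.
  by move=> v0; rewrite mule_ge0// EFin_exp_ge0// ltW//; case/andP: half01.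
pose g k i x := if i is m.+1 then U (k%:Z - m%:Z)%R x else `|f x|%:E.
have g0 k i x : 0 <= g k i x by case: i => [|i] /=; rewrite ?lee_fin.
have mg k i : measurable_fun setT (g k i).
  case: i => [|i] //=; first by apply/measurable_EFinP; exact: measurableT_comp.
  exact: mU.
(* The 2 compensates for the index shift, [2^(-i) = 2 * 2^(-(i+1))]; the 1 covers the term [|f|]. *)
pose C := (1 + 2 * K)%R.
have C0 : (0 <= C)%R by rewrite /C; lra.
exists (fun k x => C%:E * \sum_(i <oo) (2^-1 ^+ i)%:E * g k i x); split.
- move=> k; apply: measurable_funeM; apply: ge0_emeasurable_sum => [i x _ _|i _].
    exact: th0.
  exact: measurable_funeM.
- move=> k x; apply: (le_trans (hK f mf k x)).
  rewrite [X in _ <= _ * X]nneseries_recl//; last by move=> i _; exact: th0.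
  rewrite expr0 mul1e ge0_muleDr//; last by apply: nneseries_ge0 => i _ _; exact: th0.
  rewrite addeC leeD//.
    rewrite -EFinM lee_fin normrM [leRHS]/= /C ler_wpM2r//.
    by case: (k == 0%N); rewrite ?normr1 ?normr0; lra.
  rewrite -(nneseries_addn 1%N); last by move=> i; exact: th0.
  rewrite -!nneseriesZl//; last 2 first.
  - by move=> i _; exact: th0.
  - by move=> i _; exact: th0.
  apply: lee_nneseries => i _; first by rewrite mule_ge0 ?lee_fin ?(ltW K0)// th0.
  rewrite addn1 /= [leLHS]muleA [leRHS]muleA lee_wpmul2r// -!EFinM lee_fin exprS mulrA ler_wpM2r//.
  by rewrite /C; lra.
- move=> k; have [fN0 fN] : 0 <= 'N[mu]_p[EFin \o f] /\ 'N[mu]_p[EFin \o f] < +oo.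
    split; first exact: Lnorm_ge0.
    by case/andP: fp => _; rewrite inE.
  have fNf : 'N[mu]_p[EFin \o f] \is a fin_num by rewrite ge0_fin_numE.
  apply: (@Lnorm_geometric_lty _ _ _ mu p 2^-1 C ((1 + M) * fine 'N[mu]_p[EFin \o f]) (g k)) => //.
  + move=> [|i] /=; rewrite EFinM fineK//.
      have -> : 'N[mu]_p[(fun x => `|f x|%:E)] = 'N[mu]_p[EFin \o f].
        by rewrite -(Lnorm_abse mu (EFin \o f)).
      by rewrite -[leLHS]mul1e lee_wpmul2r// lee_fin; lra.
    apply: (le_trans (hM p _ f p1 mf)).
    by rewrite lee_wpmul2r// lee_fin; lra.
  + move=> x; rewrite lexx andbT mule_ge0 ?lee_fin//.
    by apply: nneseries_ge0 => i _ _; exact: th0.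
Qed.

Lemma lip_b_besov (N : nat) (p q : \bar R) : 1 <= p -> 0 < q ->
  lip_b mu D Ct s p q f -> besov_norm mu D Q N s p q T < +oo.
Proof.
move=> p1 q0 [fp fS]; have p0 : 0 < p by exact: lt_le_trans p1.
have [Phi [mPhi QPhi PhiN]] := low_frequency_majorant p1 fp.
apply: lte_add_pinfty.
  exact: (low_freq_lty hd hmu D N mPhi QPhi p1 PhiN).
have [K K0 hK] := scaled_Qapp_le.
have [K2 K20 hK2] := mosc_le_osc.
have [C1 [k [C10 k01 hC1]]] := Lnorm_geometric mu p0 half01.
have [C2 C20 hC2] := lq_convolution q0 k01.
have [k0 k1] := andP k01.
pose c (j : int) : R := (delta `^ (- (j%:~R * s)))%R.
have c0 j : (0 <= c j)%R by exact: powR_ge0.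
pose B j := 'N[mu]_p[b j].
have B0 j : 0 <= B j by exact: Lnorm_ge0.
have osc0 j x : 0 <= osc mu D Ct j f x.
  by apply: emean_ge0 => y _; rewrite lee_fin.
have BE j : B j <= K2%:E * ((c j)%:E * 'N[mu]_p[osc mu D Ct j f]).
  rewrite /B (ge0_LnormZ _ p0 (c0 j) (mU j) (U0 j)) muleCA.
  (* [K2] is moved to the side of [U j], which is measurable, so that homogeneity of the norm is not
     applied to [osc]. *)
  rewrite lee_wpmul2l ?lee_fin ?c0// -lee_pdivrMl// -ge0_LnormZ ?invr_ge0 ?(ltW K20)//.
  apply: le_Lnorm => // x; rewrite mule_ge0 ?lee_fin ?invr_ge0 ?(ltW K20)//=.
  by rewrite lee_pdivrMl//; exact: hK2.
have sum0 j : 0 <= \sum_(i <oo) (k ^+ i)%:E * B (j%:Z - i%:Z)%R.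
  by apply: nneseries_ge0 => i _ _; rewrite mule_ge0// EFin_exp_ge0// ltW.
have hb0 (j : nat) x : 0 <= \sum_(i <oo) (2^-1 ^+ i)%:E * b (j%:Z - i%:Z)%R x.
  by apply: nneseries_ge0 => i _ _; rewrite mule_ge0// EFin_exp_ge0.
have Qle (j : nat) : (N < j)%N ->
    (delta `^ (- (j%:R * s)))%:E * 'N[mu]_p[(fun x => (Qapp Q j T x)%:E)] <=
    (K * C1)%:E * \sum_(i <oo) (k ^+ i)%:E * B (j%:Z - i%:Z)%R.
  move=> Nj; rewrite -Lnorm_abse EFinM -muleA.
  have dj0 : (0 < delta `^ (j%:R * s))%R by rewrite powR_gt0// dy_delta_gt0.
  (* The weight goes to the side of the measurable majorant, where it can be pulled out of the
     norm. *)
  rewrite powRN lee_pdivrMl//.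
  apply: (@le_trans _ _ ('N[mu]_p[(fun x => (delta `^ (j%:R * s))%:E * (K%:E *
      \sum_(i <oo) (2^-1 ^+ i)%:E * b (j%:Z - i%:Z)%R x))])).
    apply: le_Lnorm => // x; rewrite /= lee_fin normr_ge0/= -lee_pdivrMl// -powRN.
    by apply: hK; exact: leq_ltn_trans Nj.
  have msum : measurable_fun setT
      (fun x => \sum_(i <oo) (2^-1 ^+ i)%:E * b (j%:Z - i%:Z)%R x).
    apply: ge0_emeasurable_sum => [i x _ _|i _]; last exact: measurable_funeM.
    by rewrite mule_ge0// EFin_exp_ge0//; case/andP: half01 => /ltW.
  rewrite ge0_LnormZ ?(ltW dj0)//; last 2 first.
  - exact: measurable_funeM.
  - by move=> x; rewrite mule_ge0// lee_fin ltW.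
  rewrite lee_wpmul2l ?lee_fin ?(ltW dj0)// ge0_LnormZ ?(ltW K0)//.
  rewrite lee_wpmul2l ?lee_fin ?(ltW K0)//.
  exact: (hC1 (fun i => b (j%:Z - i%:Z)%R)).
apply: (@le_lt_trans _ _ (lq [set j | (N < j)%N] q (fun j : nat =>
   (K * C1)%:E * \sum_(i <oo) (k ^+ i)%:E * B (j%:Z - i%:Z)%R))).
  apply: le_lq => // j Nj; rewrite mule_ge0 ?Lnorm_ge0 ?lee_fin ?powR_ge0//=.
  exact: Qle.
have KC1 : (0 <= K * C1)%R by rewrite mulr_ge0 ?ltW.
rewrite lqZl//; last by exists N.+1 => /=.
rewrite lte_mul_pinfty ?lee_fin//; apply: (le_lt_trans (hC2 N B B0)).
rewrite lte_mul_pinfty ?lee_fin ?(ltW C20)//.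
apply: (@le_lt_trans _ _ (lq [set: int] q (fun j =>
    K2%:E * ((c j)%:E * 'N[mu]_p[osc mu D Ct j f])))).
  by apply: le_lq => // j _; rewrite B0 BE.
have cN0 j : 0 <= (c j)%:E * 'N[mu]_p[osc mu D Ct j f].
  by rewrite mule_ge0 ?Lnorm_ge0// lee_fin.
rewrite lqZl ?(ltW K20)//; last by exists 0%R.
rewrite lte_mul_pinfty ?lee_fin ?(ltW K20)//.
by apply: le_lt_trans fS; rewrite leeDr// Lnorm_ge0.
Qed.

(** A single measurable [G] dominates the pointwise [l^q] quasi-norm, and serves both finite [p] and
    [p = +oo]. *)
Lemma high_frequency_majorant (N : nat) (p q : \bar R) : 1 <= p -> 0 < q ->
  lip_t mu D Ct s p q f ->
  exists G : X -> \bar R, [/\ measurable_fun setT G,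
    forall x, 0 <= lq [set k | (N < k)%N] q
      (fun k => (delta `^ (- (k%:R * s)) * `|Qapp Q k T x|)%:E) <= G x &
    'N[mu]_p[G] < +oo].
Proof.
move=> p1 q0 [fp fS]; have p0 : 0 < p by exact: lt_le_trans p1.
have [C [t [C0 t01 hC]]] := lq_Qapp_le N q0.
have [K2 K20 hK2] := mosc_le_osc.
have [M M0 hM] := Lnorm_mosc.
have osc0 j x : 0 <= osc mu D Ct j f x.
  by apply: emean_ge0 => y _; rewrite lee_fin.
have th0 i x : 0 <= (t ^+ i)%:E * h q i x.
  by rewrite mule_ge0// EFin_exp_ge0//; case/andP: t01 => /ltW.
have mh i : measurable_fun setT (h q i).
  by case: i => [|i] /=; [exact: measurable_lq|exact: mU].
exists (fun x => C%:E * \sum_(i <oo) (t ^+ i)%:E * h q i x); split.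
- by apply: measurable_funeM; apply: ge0_emeasurable_sum => [i x _ _|i _];
    [exact: th0|exact: measurable_funeM].
- move=> x; rewrite hC andbT; apply: lq_ge0; last by exists N.+1 => /=.
  by move=> k; rewrite lee_fin mulr_ge0// powR_ge0.
have fN0 : 0 <= 'N[mu]_p[EFin \o f] by exact: Lnorm_ge0.
have fNf : 'N[mu]_p[EFin \o f] \is a fin_num.
  by rewrite ge0_fin_numE//; case/andP: fp => _; rewrite inE.
pose S := 'N[mu]_p[(fun x => lq [set: nat] q (fun k =>
  (delta `^ (- (k%:R * s)))%:E * osc mu D Ct k%:Z f x))].
have S0 : 0 <= S by exact: Lnorm_ge0.
have Sf : S \is a fin_num.
  by rewrite ge0_fin_numE//; apply: le_lt_trans fS; rewrite leeDr.
apply: (@Lnorm_geometric_lty _ _ _ mu p t C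
  (M * fine 'N[mu]_p[EFin \o f] + K2 * fine S) (h q)) => //; first exact: ltW.
- move=> [|i].
    rewrite EFinD; apply: (@le_trans _ _ (K2 * fine S)%:E); last first.
      by rewrite leeDr// lee_fin mulr_ge0 ?(ltW M0)// fine_ge0.
    rewrite EFinM fineK// -lee_pdivrMl// -ge0_LnormZ ?invr_ge0 ?(ltW K20)//.
    apply: le_Lnorm => // x; rewrite mule_ge0 ?h0 ?lee_fin ?invr_ge0 ?(ltW K20)//=.
    have c0 (j : nat) : 0 <= (delta `^ (- (j%:R * s)))%:E * osc mu D Ct j%:Z f x.
      by rewrite mule_ge0// lee_fin powR_ge0.
    have nat0 : [set: nat] !=set0 by exists 0%N.
    rewrite lee_pdivrMl// -(lqZl q0 (ltW K20) c0 nat0).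
    apply: le_lq => // j _; rewrite b0/= muleCA lee_wpmul2l ?lee_fin ?powR_ge0//.
  apply: (@le_trans _ _ (M * fine 'N[mu]_p[EFin \o f])%:E); last first.
    by rewrite EFinD leeDl// lee_fin mulr_ge0 ?(ltW K20)// fine_ge0.
  by rewrite EFinM fineK//; exact: hM.
- move=> x; rewrite lexx andbT mule_ge0 ?lee_fin ?(ltW C0)//.
  by apply: nneseries_ge0 => i _ _; exact: th0.
Qed.

(** For [p = +oo], the tail starting at [l > N] is part of the sum bounded by [G], so each mean over
    a cube is at most the essential supremum of [G^q]. *)
Lemma lip_t_triebel (N : nat) (p q : \bar R) : 1 <= p -> 0 < q ->
  lip_t mu D Ct s p q f -> triebel_norm mu D Q N s p q T < +oo.
Proof.
move=> p1 q0 hf; have p0 : 0 < p by exact: lt_le_trans p1.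
have [fp _] := hf.
have [Phi [mPhi QPhi PhiN]] := low_frequency_majorant p1 fp.
have [G [mG QG GN]] := high_frequency_majorant N p1 q0 hf.
case: p p1 p0 hf fp PhiN GN => [p||] // p1 p0 hf fp PhiN GN.
  apply: lte_add_pinfty; first exact: (low_freq_lty hd hmu D N mPhi QPhi p1 PhiN).
  by apply: le_lt_trans GN; exact: le_Lnorm.
rewrite /triebel_norm /triebel_norm_infty gt_max.
rewrite (sup_absmean_lty hd hmu D N mPhi QPhi)//=.
have G0 x : 0 <= G x by have /andP[] := QG x; exact: le_trans.
apply: (le_lt_trans _ GN); apply: ge_ereal_sup => _ [l [a [Nl la ->]]].
have mE := dy_measurable la; have Efin := cube_fin hd hmu la.
have muT : 0 < mu setT.
  have /andP[Q0 _] := Efin; apply: (lt_le_trans Q0).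
  by apply: le_measure; rewrite ?inE.
set M := 'N[mu]_(+oo)[G]; have M0 : 0 <= M by exact: Lnorm_ge0.
have GM : \forall x \ae mu, G x <= M.
  rewrite /M unlock muT; have := ess_sup_ge mu (abse \o G).
  by apply: filterS => x; rewrite /= gee0_abs.
have sub : [set k | (l <= k)%N] `<=` [set k | (N < k)%N].
  by move=> k /=; exact: leq_trans.
case: q q0 hf QG => [q||] // q0 hf QG; rewrite /triebel_tail; last first.
  apply/ess_supP; apply: filterS GM => x GxM.
  rewrite /patch; case: ifPn => _ //; apply: le_trans GxM.
  have /andP[_] := QG x; apply: le_trans.
  exact: ereal_sup_le (image_subset _ sub).
rewrite lte_fin in q0.
rewrite -[leRHS](poweRK q0 M0); apply: le_poweR; first by rewrite invr_ge0 ltW.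
  apply: emean_ge0 => x _; apply: esum_ge0 => k _.
  by rewrite lee_fin mulr_ge0// powR_ge0.
apply: (@le_trans _ _ (emean mu (dy_cube D l%:Z a) (fun x => G x `^ q))).
  apply: le_emean => x _; apply/andP; split.
    by apply: esum_ge0 => k _; rewrite lee_fin mulr_ge0// powR_ge0.
  have /andP[lq0 lqG] := QG x.
  apply: le_trans (le_poweR (ltW q0) lq0 lqG); rewrite /= poweRVK//; last first.
    by apply: esum_ge0 => k _; rewrite lee_fin powR_ge0.
  apply: (@le_trans _ _ (\esum_(k in [set k | (l <= k)%N])
      ((delta `^ (- (k%:R * s)) * `|Qapp Q k T x|) `^ q)%:E)).
    apply: le_esum => k _; rewrite lee_fin powRM ?powR_ge0//.
    by rewrite -powRrM mulNr.
  exact: subset_esum.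
apply: emean_ae_le => //.
- exact: (measurableT_comp (measurable_poweR _)).
- by move=> x; exact: poweR_ge0.
- by apply: filterS GM => x; apply: le_poweR => //; exact: ltW.
- exact: poweR_ge0.
Qed.

End lipschitz_embeddings.

Theorem proposition5p1 (R : realType) (disp : measure_display)
  (X : measurableType disp) (mu : {measure set X -> \bar R})
  (d : X -> X -> R) (A0 Cmu : R)
  (hd : quasi_metric d A0) (hmu : homogeneous_type d mu Cmu)
  (I : choiceType) (D : dyadic_system I d A0)
  (eta : R) (heta : 0 < eta < 1)
  (Q : nat -> X -> X -> R) (hQ : exp_IATI mu D eta Q)
  (x0 : X) (r0 : R) (hr0 : 0 < r0)
  (beta gamma s : R) (hbeta : 0 < beta < eta) (hgamma : 0 < gamma < eta)
  (hs : 0 < s < Num.min beta gamma)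
  (N : nat) (hN : calderon_number mu D x0 r0 eta beta gamma Q N)
  (Ct : R) (hCt : 0 < Ct) :
  (forall p q : \bar R, (1%:E <= p)%E -> (0%:E < q)%E ->
     forall f : X -> R, lip_b mu D Ct s p q f ->
       besov mu D x0 r0 eta beta gamma Q N s p q (distr_of_fun mu f)) /\
  (forall p q : \bar R, (1%:E <= p)%E ->
     ((upper_dim Cmu / (upper_dim Cmu + Num.min beta gamma))%:E < q)%E ->
     forall f : X -> R, lip_t mu D Ct s p q f ->
       triebel_lizorkin mu D x0 r0 eta beta gamma Q N s p q
         (distr_of_fun mu f)).
Proof.
have [mu' mu'E] := exists_sigma_finite_measure (homogeneous_sigma_finite hmu x0).
subst mu.
have Ctd j : 0 < Ct * dy_delta D ^ j by rewrite mulr_gt0// expz_delta_gt0.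
have [P hP] := choice (fun j => measurable_ball_family hd hmu D (Ctd j)).
have mP j := (hP j).1; have sP j x := (hP j).2 x.
have s0 : 0 < s by case/andP: hs.
have gamma0 : 0 < gamma by case/andP: hgamma.
have mf p f : f \in Lfun mu' p -> measurable_fun setT f.
  by case/andP; rewrite inE.
split=> p q p1 q0 f hf; have [fp _] := hf; split.
- exact: (Lfun_distribution hd hmu x0 hr0 eta beta gamma0 p1 fp).
- exact: (lip_b_besov hd hmu hCt mP sP hQ s0 (mf _ _ fp)).
- exact: (Lfun_distribution hd hmu x0 hr0 eta beta gamma0 p1 fp).
- apply: (lip_t_triebel hd hmu hCt mP sP hQ s0 (mf _ _ fp)) => //.
  (* The lower bound on [q] is nonnegative because [Cmu >= 1], whence [q > 0]. *)
  apply: le_lt_trans q0; rewrite lee_fin.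
  have w0 : 0 <= upper_dim Cmu.
    by rewrite divr_ge0 ?ln_ge0 ?ler1n//; case: hmu.
  rewrite divr_ge0// addr_ge0// le_min.
  by case/andP: hbeta => /ltW -> _; rewrite ltW.
Qed.
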